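(* Let $\mathsf{W}$ be a sentence of $\mathsf{L}_\omega$ such that $\mathsf{RCA}_0^\omega$ proves $\mathsf{MUC}\to\mathsf{W}$, $(\exists^3)\to\mathsf{W}$ and $\mathsf{W}\to(\kappa_0^3)$. Then $\mathsf{WKL}_0^\omega+\mathsf{QF\text{-}AC}^{2,0}$ proves $\mathsf{W}\leftrightarrow(\kappa_0^3)$.
   Context: $\mathsf{L}_\omega$ is the language of higher-order arithmetic with variables of all finite types: $0$ is the type of natural numbers and $\sigma\to\tau$ the type of mappings; $1=0\to0$, $2=1\to0$, $3=2\to0$. Equality at higher types is pointwise; $\le_\tau$ is defined pointwise using $\le_0$. $\mathsf{RCA}_0^\omega$ is Kohlenbach's base theory: basic axioms making $0,1,<,+,\times$ an ordered semiring, the combinators $K,S$, the recursor $\mathbf{R}_0$ ($\mathbf{R}_0(f,m,0)=m$, $\mathbf{R}_0(f,m,n+1)=f(\mathbf{R}_0(f,m,n))$), extensionality at all types, quantifier-free induction, and $\mathsf{QF\text{-}AC}^{1,0}$. $\mathsf{QF\text{-}AC}^{\sigma,\tau}$ is the schema $(\forall x^\sigma)(\exists y^\tau)A(x,y)\to(\exists Y^{\sigma\to\tau})(\forall x^\sigma)A(x,Y(x))$ for quantifier-free $A$. $\mathsf{WKL}$: every infinite binary tree has a path; $\mathsf{WKL}_0^\omega=\mathsf{RCA}_0^\omega+\mathsf{WKL}$. $\overline{f}n=\langle f(0),\dots,f(n-1)\rangle$; $C$ is the set of $f^1\le_1 1$. $(\exists^3)$: $(\exists E^3\le_3 1)(\forall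 Y^2)\big[(\exists f^1)(Y(f)=0)\leftrightarrow E(Y)=0\big]$. $(\kappa_0^3)$: $(\exists \kappa_0^3)(\forall Y^2)\big[\kappa_0(Y)=0\leftrightarrow(\exists f\in C)(Y(f)>0)\big]$. $\mathsf{MUC}$: $(\exists\Omega^3)(\forall Y^2)(\forall f,g\in C)(\overline f\Omega(Y)=\overline g\Omega(Y)\to Y(f)=Y(g))$. *)

(* Defs.v *)
From Stdlib Require Import List.
Import ListNotations.
Set Implicit Arguments.

Inductive ty : Type :=
| N : ty
| Arr : ty -> ty -> ty.

Declare Scope ho_scope.
Delimit Scope ho_scope with ho.
Open Scope ho_scope.
Notation "s ~> t" := (Arr s t) (at level 60, right associativity).

Notation ty1 := (N ~> N).
Notation ty2 := (ty1 ~> N).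
Notation ty3 := (ty2 ~> N).

(** Terms and formulas are intrinsically typed and scoped: [ctx] lists the types
    of the free variables, de Bruijn index [0] being the head of the list.
    A sentence is a formula over the empty context. *)
Definition ctx := list ty.

Inductive var : ctx -> ty -> Type :=
| vz : forall G s, var (s :: G) s
| vs : forall G s t, var G s -> var (t :: G) s.
Arguments vz {G s}.
Arguments vs {G s t} _.

Inductive tm (G : ctx) : ty -> Type :=
| Var : forall s, var G s -> tm G s
| App : forall s t, tm G (s ~> t) -> tm G s -> tm G t
| Zero : tm G N
| One : tm G N
| Plus : tm G (N ~> N ~> N)
| Times : tm G (N ~> N ~> N)
| Kc : forall r s, tm G (r ~> s ~> r)
| Sc : forall r s t, tm G ((r ~> s ~> t) ~> (r ~> s) ~> r ~> t)
| R0 : tm G (ty1 ~> N ~> N ~> N).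
Arguments Zero {G}.
Arguments One {G}.
Arguments Plus {G}.
Arguments Times {G}.
Arguments Kc {G} r s.
Arguments Sc {G} r s t.
Arguments R0 {G}.

(** The only prime formulas are equations and inequalities of type [N]. *)
Inductive fm : ctx -> Type :=
| Eqn : forall G, tm G N -> tm G N -> fm G
| Less : forall G, tm G N -> tm G N -> fm G
| Bot : forall G, fm G
| Imp : forall G, fm G -> fm G -> fm G
| And : forall G, fm G -> fm G -> fm G
| Or : forall G, fm G -> fm G -> fm G
| All : forall G s, fm (s :: G) -> fm G
| Ex : forall G s, fm (s :: G) -> fm G.
Arguments Bot {G}.
Arguments All {G} s _.
Arguments Ex {G} s _.

Definition Iff {G} (A B : fm G) : fm G := And (Imp A B) (Imp B A).

Definition sentence := fm [].
Definition theory := sentence -> Prop.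

Fixpoint qf {G} (A : fm G) : Prop :=
  match A with
  | Eqn _ _ | Less _ _ | Bot => True
  | Imp A B | And A B | Or A B => qf A /\ qf B
  | All _ _ | Ex _ _ => False
  end.

Definition ren (G D : ctx) := forall s, var G s -> var D s.
Definition sub (G D : ctx) := forall s, var G s -> tm D s.

(** [scons_var a f] sends index [0] to [a] and index [i+1] to [f i], for any
    family [P] of targets. *)
Definition scons_var (P : ty -> Type) {G t} (a : P t) (f : forall s, var G s -> P s)
  : forall s, var (t :: G) s -> P s :=
  fun s x =>
    match x in var G' s'
      return match G' with
             | [] => unit
             | t' :: G0 => P t' -> (forall s, var G0 s -> P s) -> P s'
             end
    with
    | vz => fun a _ => a
    | vs y => fun _ f => f _ y
    end a f.

Definition up_ren {G D} t (f : ren G D) : ren (t :: G) (t :: D) :=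
  scons_var (var (t :: D)) vz (fun s x => vs (f s x)).

Fixpoint ren_tm {G D s} (f : ren G D) (u : tm G s) : tm D s :=
  match u with
  | Var x => Var (f _ x)
  | App u v => App (ren_tm f u) (ren_tm f v)
  | Zero => Zero
  | One => One
  | Plus => Plus
  | Times => Times
  | Kc r s => Kc r s
  | Sc r s t => Sc r s t
  | R0 => R0
  end.

Definition shift {G} t : ren G (t :: G) := fun _ x => vs x.
Definition wk {G s t} (u : tm G s) : tm (t :: G) s := ren_tm (@shift G t) u.

Definition up {G D} t (f : sub G D) : sub (t :: G) (t :: D) :=
  scons_var (tm (t :: D)) (Var vz) (fun s x => wk (f s x)).

Fixpoint sub_tm {G D s} (f : sub G D) (u : tm G s) : tm D s :=
  match u with
  | Var x => f _ x
  | App u v => App (sub_tm f u) (sub_tm f v)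
  | Zero => Zero
  | One => One
  | Plus => Plus
  | Times => Times
  | Kc r s => Kc r s
  | Sc r s t => Sc r s t
  | R0 => R0
  end.

Fixpoint ren_fm {G} (A : fm G) : forall D, ren G D -> fm D :=
  match A with
  | Eqn u v => fun D f => Eqn (ren_tm f u) (ren_tm f v)
  | Less u v => fun D f => Less (ren_tm f u) (ren_tm f v)
  | Bot => fun D _ => Bot
  | Imp A B => fun D f => Imp (ren_fm A f) (ren_fm B f)
  | And A B => fun D f => And (ren_fm A f) (ren_fm B f)
  | Or A B => fun D f => Or (ren_fm A f) (ren_fm B f)
  | All t A => fun D f => All t (ren_fm A (up_ren f))
  | Ex t A => fun D f => Ex t (ren_fm A (up_ren f))
  end.

Fixpoint sub_fm {G} (A : fm G) : forall D, sub G D -> fm D :=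
  match A with
  | Eqn u v => fun D f => Eqn (sub_tm f u) (sub_tm f v)
  | Less u v => fun D f => Less (sub_tm f u) (sub_tm f v)
  | Bot => fun D _ => Bot
  | Imp A B => fun D f => Imp (sub_fm A f) (sub_fm B f)
  | And A B => fun D f => And (sub_fm A f) (sub_fm B f)
  | Or A B => fun D f => Or (sub_fm A f) (sub_fm B f)
  | All t A => fun D f => All t (sub_fm A (up f))
  | Ex t A => fun D f => Ex t (sub_fm A (up f))
  end.

Definition wk_fm {G t} (A : fm G) : fm (t :: G) := ren_fm A (@shift G t).

Definition inst {G t} (A : fm (t :: G)) (u : tm G t) : fm G :=
  sub_fm A (scons_var (tm G) u (@Var G)).

Definition no_var (G : ctx) : ren [] G :=
  fun s x =>
    match x in var G' s' return match G' with [] => var G s' | _ => unit end with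
    | vz => tt
    | vs _ => tt
    end.

Definition embed {G} (A : sentence) : fm G := ren_fm A (no_var G).

Fixpoint close (G : ctx) : fm G -> sentence :=
  match G with
  | [] => fun A => A
  | t :: G' => fun A => close (All t A)
  end.

Inductive prv (T : theory) : forall G : ctx, list (fm G) -> fm G -> Prop :=
| Ax : forall G (H : list (fm G)) A, T A -> prv T H (embed A)
| Hyp : forall G (H : list (fm G)) A, In A H -> prv T H A
| ImpI : forall G (H : list (fm G)) A B, prv T (A :: H) B -> prv T H (Imp A B)
| ImpE : forall G (H : list (fm G)) A B,
    prv T H (Imp A B) -> prv T H A -> prv T H B
| AndI : forall G (H : list (fm G)) A B,
    prv T H A -> prv T H B -> prv T H (And A B)
| AndE1 : forall G (H : list (fm G)) A B, prv T H (And A B) -> prv T H A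
| AndE2 : forall G (H : list (fm G)) A B, prv T H (And A B) -> prv T H B
| OrI1 : forall G (H : list (fm G)) A B, prv T H A -> prv T H (Or A B)
| OrI2 : forall G (H : list (fm G)) A B, prv T H B -> prv T H (Or A B)
| OrE : forall G (H : list (fm G)) A B C,
    prv T H (Or A B) -> prv T (A :: H) C -> prv T (B :: H) C -> prv T H C
| AllI : forall G (H : list (fm G)) t (A : fm (t :: G)),
    prv T (map wk_fm H) A -> prv T H (All t A)
| AllE : forall G (H : list (fm G)) t (A : fm (t :: G)) (u : tm G t),
    prv T H (All t A) -> prv T H (inst A u)
| ExI : forall G (H : list (fm G)) t (A : fm (t :: G)) (u : tm G t),
    prv T H (inst A u) -> prv T H (Ex t A)
| ExE : forall G (H : list (fm G)) t (A : fm (t :: G)) B,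
    prv T H (Ex t A) -> prv T (A :: map wk_fm H) (wk_fm B) -> prv T H B
| RAA : forall G (H : list (fm G)) A, prv T (Imp A Bot :: H) Bot -> prv T H A
| EqI : forall G (H : list (fm G)) (u : tm G N), prv T H (Eqn u u)
| EqE : forall G (H : list (fm G)) (u v : tm G N) (A : fm (N :: G)),
    prv T H (Eqn u v) -> prv T H (inst A u) -> prv T H (inst A v).

Definition proves (T : theory) (A : sentence) : Prop := prv T (G := []) [] A.

Notation v0 := (Var vz).
Notation v1 := (Var (vs vz)).
Notation v2 := (Var (vs (vs vz))).
Notation v3 := (Var (vs (vs (vs vz)))).

Infix "@" := App (at level 36, left associativity) : ho_scope.
Notation "u [+] v" := (Plus @ u @ v) (at level 50, left associativity) : ho_scope.
Notation "u [*] v" := (Times @ u @ v) (at level 40, left associativity) : ho_scope.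
Infix "[=]" := Eqn (at level 70) : ho_scope.
Infix "[<]" := Less (at level 70) : ho_scope.
Infix "[->]" := Imp (at level 85, right associativity) : ho_scope.
Infix "[<->]" := Iff (at level 86, no associativity) : ho_scope.
Infix "[/\]" := And (at level 75, right associativity) : ho_scope.
Infix "[\/]" := Or (at level 80, right associativity) : ho_scope.

Fixpoint eq_at (s : ty) : forall G, tm G s -> tm G s -> fm G :=
  match s with
  | N => fun G u v => u [=] v
  | s' ~> t => fun G u v => All s' (eq_at (wk u @ v0) (wk v @ v0))
  end.

Fixpoint le_at (s : ty) : forall G, tm G s -> tm G s -> fm G :=
  match s with
  | N => fun G u v => u [<] v [\/] u [=] v
  | s' ~> t => fun G u v => All s' (le_at (wk u @ v0) (wk v @ v0))
  end.

Infix "[==]" := (@eq_at _ _) (at level 70) : ho_scope.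
Infix "[<=]" := (@le_at _ _) (at level 70) : ho_scope.

(** The constant functional with value [1]. *)
Fixpoint one_at {G} (s : ty) : tm G s :=
  match s with
  | N => One
  | s' ~> t => Kc t s' @ one_at t
  end.

Definition inC {G} (f : tm G ty1) : fm G := f [<=] one_at ty1.

(** Finite sequences are coded by [<> = 0] and [s * <x> = (s, x) + 1], where
    [(i, j) = (i + j)^2 + i] is injective. *)
Definition pair_code {G} (i j : tm G N) : tm G N := (i [+] j) [*] (i [+] j) [+] i.

(** [s] is the code of [<f(0), ..., f(n-1)>]:
    exists h, h(0) = 0 /\ (forall i < n, h(i+1) = (h(i), f(i)) + 1) /\ h(n) = s *)
Definition initseg {G} (f : tm G ty1) (n s : tm G N) : fm G :=
  Ex ty1 (v0 @ Zero [=] Zero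
    [/\] All N (v0 [<] wk (wk n) [->]
                v1 @ (v0 [+] One) [=] pair_code (v1 @ v0) (wk (wk f) @ v0) [+] One)
    [/\] v0 @ wk n [=] wk s).

Definition initseg_eq {G} (f : tm G ty1) (n : tm G N) (g : tm G ty1) (m : tm G N)
  : fm G :=
  Ex N (initseg (wk f) (wk n) v0 [/\] initseg (wk g) (wk m) v0).

(** Universally closed statements [forall x y z, ...] of type [N] are written in
    the context [[N; N; N]], with [x = v2], [y = v1], [z = v0] (and similarly
    for other contexts: the leftmost quantifier has the highest index). *)
Inductive ordered_semiring : theory :=
| add_assoc : ordered_semiring
    (close (G := [N; N; N]) ((v2 [+] v1) [+] v0 [=] v2 [+] (v1 [+] v0)))
| add_comm : ordered_semiring (close (G := [N; N]) (v1 [+] v0 [=] v0 [+] v1))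
| add_0 : ordered_semiring (close (G := [N]) (v0 [+] Zero [=] v0))
| mul_assoc : ordered_semiring
    (close (G := [N; N; N]) ((v2 [*] v1) [*] v0 [=] v2 [*] (v1 [*] v0)))
| mul_comm : ordered_semiring (close (G := [N; N]) (v1 [*] v0 [=] v0 [*] v1))
| mul_0 : ordered_semiring (close (G := [N]) (v0 [*] Zero [=] Zero))
| mul_1 : ordered_semiring (close (G := [N]) (v0 [*] One [=] v0))
| mul_add : ordered_semiring
    (close (G := [N; N; N]) (v2 [*] (v1 [+] v0) [=] v2 [*] v1 [+] v2 [*] v0))
| lt_irrefl : ordered_semiring (close (G := [N]) (v0 [<] v0 [->] Bot))
| lt_trans : ordered_semiring
    (close (G := [N; N; N]) (v2 [<] v1 [->] v1 [<] v0 [->] v2 [<] v0))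
| lt_total : ordered_semiring
    (close (G := [N; N]) (v1 [<] v0 [\/] v1 [=] v0 [\/] v0 [<] v1))
| lt_add : ordered_semiring
    (close (G := [N; N; N]) (v2 [<] v1 [->] v2 [+] v0 [<] v1 [+] v0))
| lt_mul : ordered_semiring
    (close (G := [N; N; N])
       (v2 [<] v1 [->] Zero [<] v0 [->] v2 [*] v0 [<] v1 [*] v0))
| lt_0_1 : ordered_semiring (Zero [<] One)
| nonneg : ordered_semiring (close (G := [N]) (v0 [<] Zero [->] Bot))
| discrete : ordered_semiring
    (close (G := [N; N]) (v1 [<] v0 [+] One [<->] v1 [<] v0 [\/] v1 [=] v0)).

(** [A(x, y)] has [x = v1], [y = v0] and parameters [G]; the substitution reads it
    as [A(x, Y(x))] in the context [x, Y, G]. *)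
Definition ac_sub G s t : sub (t :: s :: G) (s :: (s ~> t) :: G) :=
  scons_var (tm (s :: (s ~> t) :: G)) (v1 @ v0)
    (scons_var (tm (s :: (s ~> t) :: G)) v0 (fun _ x => Var (vs (vs x)))).

Inductive QF_AC (s t : ty) : theory :=
| qf_ac : forall G (A : fm (t :: s :: G)), qf A ->
    QF_AC s t (close (All s (Ex t A)
                      [->] Ex (s ~> t) (All s (sub_fm A (@ac_sub G s t))))).

Definition succ_sub G : sub (N :: G) (N :: G) :=
  scons_var (tm (N :: G)) (v0 [+] One) (fun _ x => Var (vs x)).

Inductive RCA0w : theory :=
| rca_basic : forall A, ordered_semiring A -> RCA0w A
| rca_K : forall r s,
    RCA0w (close (G := [s; r]) (Kc r s @ v1 @ v0 [==] v1))
| rca_S : forall r s t,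
    RCA0w (close (G := [r; r ~> s; r ~> s ~> t])
             (Sc r s t @ v2 @ v1 @ v0 [==] v2 @ v0 @ (v1 @ v0)))
| rca_R0_0 : RCA0w (close (G := [N; ty1]) (R0 @ v1 @ v0 @ Zero [=] v0))
| rca_R0_succ :
    RCA0w (close (G := [N; N; ty1])
             (R0 @ v2 @ v1 @ (v0 [+] One) [=] v2 @ (R0 @ v2 @ v1 @ v0)))
| rca_ext : forall r s,
    RCA0w (close (G := [r; r; r ~> s])
             (v1 [==] v0 [->] v2 @ v1 [==] v2 @ v0))
| rca_ind : forall G (A : fm (N :: G)), qf A ->
    RCA0w (close (inst A Zero [->] All N (A [->] sub_fm A (@succ_sub G))
                  [->] All N A))
| rca_ac : forall A, QF_AC ty1 N A -> RCA0w A.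

(** Membership of (the code) [s] in a tree [T] of type [1] means [T(s) = 0]. *)
Definition mem {G} (s : tm G N) (T : tm G ty1) : fm G := T @ s [=] Zero.

(** [s] codes a binary sequence of length [n]. *)
Definition binseq {G} (s n : tm G N) : fm G :=
  Ex ty1 (inC v0 [/\] initseg v0 (wk n) (wk s)).

(** [s] codes an initial segment of the sequence coded by [t]:
    exists f, m, n, m <= n and the codes of f|m and f|n are [s] and [t]. *)
Definition prefix {G} (s t : tm G N) : fm G :=
  Ex ty1 (Ex N (Ex N (v1 [<=] v0
    [/\] initseg v2 v1 (wk (wk (wk s)))
    [/\] initseg v2 v0 (wk (wk (wk t)))))).

Definition binary_tree {G} (T : tm G ty1) : fm G :=
  All N (mem v0 (wk T) [->] Ex N (binseq v1 v0))
  [/\] All N (All N (prefix v1 v0 [->] mem v0 (wk (wk T)) [->] mem v1 (wk (wk T)))).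

(** forall n, T has an element of length n *)
Definition infinite_tree {G} (T : tm G ty1) : fm G :=
  All N (Ex N (binseq v0 v1 [/\] mem v0 (wk (wk T)))).

Definition has_path {G} (T : tm G ty1) : fm G :=
  Ex ty1 (inC v0 [/\] All N (Ex N (initseg v2 v1 v0 [/\] mem v0 (wk (wk (wk T)))))).

Definition WKL : sentence :=
  All ty1 (binary_tree v0 [/\] infinite_tree v0 [->] has_path v0).

Inductive WKL0w : theory :=
| wkl_rca : forall A, RCA0w A -> WKL0w A
| wkl_wkl : WKL0w WKL.

Definition theory_union (T U : theory) : theory := fun A => T A \/ U A.

(** (exists E <= 1)(forall Y)[(exists f)(Y(f) = 0) <-> E(Y) = 0] *)
Definition exists3 : sentence :=
  Ex ty3 (v0 [<=] one_at ty3
    [/\] All ty2 (Ex ty1 (v1 @ v0 [=] Zero) [<->] v1 @ v0 [=] Zero)).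

(** (exists k)(forall Y)[k(Y) = 0 <-> (exists f in C)(Y(f) > 0)] *)
Definition kappa0 : sentence :=
  Ex ty3 (All ty2 (v1 @ v0 [=] Zero
    [<->] Ex ty1 (inC v0 [/\] Zero [<] v1 @ v0))).

(** (exists O)(forall Y)(forall f, g in C)(f|O(Y) = g|O(Y) -> Y(f) = Y(g)) *)
Definition MUC : sentence :=
  Ex ty3 (All ty2 (All ty1 (All ty1 (
    inC v1 [->] inC v0 [->]
    initseg_eq v1 (v3 @ v2) v0 (v3 @ v2) [->] v2 @ v1 [=] v2 @ v0)))).

(* Main.v *)
(** The equivalence reduces to [kappa_0 -> MUC \/ exists^3], since [W] follows from either
    disjunct and implies [kappa_0]. This disjunction is checked in all extensional models and
    transferred to a derivation by a Henkin completeness theorem.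

    In a model of the base theory with [kappa_0], split on [exists^2]. If it holds, its
    witness decodes points of Cantor space, read as graphs, into arbitrary elements of Baire space,
    and [kappa_0] becomes [exists^3]. If it fails, every type-2 functional [G] is
    bounded on Cantor space: were [G] unbounded, [kappa_0] would decide [exists n, h(n) = 0] as
    [exists f in C, exists n < G(f), h(n) = 0]. Apply this to a functional which, on [f, g] in [C]
    with [Y(f) <> Y(g)], chooses a place where [f] and [g] differ: the bound is a modulus
    of uniform continuity for [Y]. Whether a number is such a modulus is decided by [kappa_0], hence
    [QF-AC^{2,0}] gives [MUC]. *)

From Stdlib Require Import List PeanoNat Ring Eqdep Program.Equality
  FunctionalExtensionality PropExtensionality ClassicalEpsilon.
Require Import Defs.
Import ListNotations.
Set Implicit Arguments.

(** * Substitution and admissible rules *)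

(** The motive of the [match] is trivial on the empty context and takes [P] as an argument on an
    extended one, so the index need not be inverted. *)
Lemma var_case {G t} (P : forall s, var (t :: G) s -> Prop)
  (h0 : P t vz) (hS : forall s (x : var G s), P s (vs x)) s (x : var (t :: G) s) : P s x.
Proof.
  refine (match x as x' in var G' s'
    return (match G' as G0 return (var G0 s' -> Prop) with
            | [] => fun _ => True
            | t' :: G0 => fun x' => forall P : forall s, var (t' :: G0) s -> Prop,
                P t' vz -> (forall s (x : var G0 s), P s (vs x)) -> P s' x'
            end x') with
    | vz => fun P h _ => h
    | vs y => fun P _ h => h _ y
    end P h0 hS).
Qed.

Lemma var_nil s (x : var [] s) : False.
Proof.
  exact (match x in var G' s' return match G' with [] => False | _ => True end with
         | vz => I | vs _ => I end).
Qed.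

(** Through this, every commutation law under a binder reduces to the fresh variable and the shifted
    ones. *)
Lemma var_fun_ext {G t} (P : ty -> Type) (f g : forall s, var (t :: G) s -> P s) :
  f t vz = g t vz -> (forall s (x : var G s), f s (vs x) = g s (vs x)) -> f = g.
Proof.
  intros h0 hS; apply functional_extensionality_dep; intro s.
  apply functional_extensionality_dep; intro x; revert s x.
  apply var_case; auto.
Qed.

Lemma ren_tm_sub {G D s} (f : ren G D) (u : tm G s) :
  ren_tm f u = sub_tm (fun s x => Var (f s x)) u.
Proof. induction u; simpl; congruence. Qed.

Lemma sub_ren_tm {G D E s} (f : ren G D) (g : sub D E) (u : tm G s) :
  sub_tm g (ren_tm f u) = sub_tm (fun s x => g s (f s x)) u.
Proof. induction u; simpl; congruence. Qed.

Lemma ren_sub_tm {G D E s} (f : sub G D) (g : ren D E) (u : tm G s) :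
  ren_tm g (sub_tm f u) = sub_tm (fun s x => ren_tm g (f s x)) u.
Proof. induction u; simpl; congruence. Qed.

Lemma sub_sub_tm {G D E s} (f : sub G D) (g : sub D E) (u : tm G s) :
  sub_tm g (sub_tm f u) = sub_tm (fun s x => sub_tm g (f s x)) u.
Proof. induction u; simpl; congruence. Qed.

Lemma ren_ren_tm {G D E s} (f : ren G D) (g : ren D E) (u : tm G s) :
  ren_tm g (ren_tm f u) = ren_tm (fun s x => g s (f s x)) u.
Proof. induction u; simpl; congruence. Qed.

Lemma sub_id_tm {G s} (u : tm G s) : sub_tm (@Var G) u = u.
Proof. induction u; simpl; congruence. Qed.

Lemma ren_id_tm {G s} (u : tm G s) : ren_tm (fun _ x => x) u = u.
Proof. induction u; simpl; congruence. Qed.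

Lemma up_Var {G t} : up (t := t) (@Var G) = @Var (t :: G).
Proof. now apply var_fun_ext. Qed.

Lemma ren_fm_sub {G} (A : fm G) : forall D (f : ren G D),
  ren_fm A f = sub_fm A (fun s x => Var (f s x)).
Proof.
  induction A; intros D f; simpl; rewrite ?ren_tm_sub, ?IHA1, ?IHA2, ?IHA; try reflexivity;
    do 2 f_equal; now apply var_fun_ext.
Qed.

Lemma ren_ren_fm {G} (A : fm G) : forall D E (f : ren G D) (g : ren D E),
  ren_fm (ren_fm A f) g = ren_fm A (fun s x => g s (f s x)).
Proof.
  induction A; intros D E f g; simpl; rewrite ?ren_ren_tm, ?IHA1, ?IHA2, ?IHA; try reflexivity;
    do 2 f_equal; now apply (var_fun_ext (var _)).
Qed.

Lemma sub_ren_fm {G} (A : fm G) : forall D E (f : ren G D) (g : sub D E),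
  sub_fm (ren_fm A f) g = sub_fm A (fun s x => g s (f s x)).
Proof.
  induction A; intros D E f g; simpl; rewrite ?sub_ren_tm, ?IHA1, ?IHA2, ?IHA; try reflexivity;
    do 2 f_equal; now apply var_fun_ext.
Qed.

Lemma ren_sub_fm {G} (A : fm G) : forall D E (f : sub G D) (g : ren D E),
  ren_fm (sub_fm A f) g = sub_fm A (fun s x => ren_tm g (f s x)).
Proof.
  induction A; intros D E f g; simpl; rewrite ?ren_sub_tm, ?IHA1, ?IHA2, ?IHA; try reflexivity;
    do 2 f_equal; apply var_fun_ext; try reflexivity; intros; simpl; unfold wk;
    now rewrite !ren_ren_tm.
Qed.

Lemma sub_sub_fm {G} (A : fm G) : forall D E (f : sub G D) (g : sub D E),
  sub_fm (sub_fm A f) g = sub_fm A (fun s x => sub_tm g (f s x)).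
Proof.
  induction A; intros D E f g; simpl; rewrite ?sub_sub_tm, ?IHA1, ?IHA2, ?IHA; try reflexivity;
    do 2 f_equal; apply var_fun_ext; try reflexivity; intros; simpl; unfold wk;
    now rewrite sub_ren_tm, ren_sub_tm.
Qed.

Lemma sub_id_fm {G} (A : fm G) : sub_fm A (@Var G) = A.
Proof.
  induction A; simpl; rewrite ?sub_id_tm, ?up_Var; congruence.
Qed.

Lemma ren_id_fm {G} (A : fm G) : ren_fm A (fun _ x => x) = A.
Proof. rewrite ren_fm_sub; apply sub_id_fm. Qed.

Lemma ren_wk {G D t} (A : fm G) (f : ren G D) :
  ren_fm (wk_fm (t := t) A) (up_ren f) = wk_fm (ren_fm A f).
Proof. unfold wk_fm; now rewrite !ren_ren_fm. Qed.

Lemma map_ren_wk {G D t} (H : list (fm G)) (f : ren G D) :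
  map (fun B => ren_fm B (up_ren f)) (map (wk_fm (t := t)) H) = map wk_fm (map (fun B => ren_fm B f) H).
Proof. rewrite !map_map; apply map_ext; intro; apply ren_wk. Qed.

Lemma ren_inst {G D t} (A : fm (t :: G)) (u : tm G t) (f : ren G D) :
  ren_fm (inst A u) f = inst (ren_fm A (up_ren f)) (ren_tm f u).
Proof.
  unfold inst; rewrite ren_sub_fm, sub_ren_fm; f_equal; now apply var_fun_ext.
Qed.

(** The renaming frees index [1] and the instantiation closes the gap again; this opens a quantifier
    with a fresh variable. *)
Lemma inst_var0 {G t} (A : fm (t :: G)) : inst (ren_fm A (up_ren (@shift G t))) v0 = A.
Proof.
  unfold inst; rewrite sub_ren_fm; rewrite <- (sub_id_fm A) at 2.
  f_equal; now apply var_fun_ext.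
Qed.

Lemma ren_closed (A : sentence) {D} (f g : ren [] D) : ren_fm A f = ren_fm A g.
Proof.
  f_equal; apply functional_extensionality_dep; intro s.
  apply functional_extensionality_dep; intro x; destruct (var_nil x).
Qed.

Lemma ren_embed {G D} (A : sentence) (f : ren G D) : ren_fm (embed A) f = embed A.
Proof. unfold embed; rewrite ren_ren_fm; apply ren_closed. Qed.

Lemma embed_nil (A : sentence) : embed A = A.
Proof. rewrite <- (ren_id_fm A) at 2; apply ren_closed. Qed.

(** * Structural properties of derivations *)

Lemma prv_weaken T G (H : list (fm G)) A :
  prv T H A -> forall H', incl H H' -> prv T H' A.
Proof.
  induction 1; intros H' hi.
  - now apply Ax.
  - apply Hyp; auto.
  - apply ImpI, IHprv; intros x [->|hx]; [now left | right; auto].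
  - eapply ImpE; eauto.
  - apply AndI; auto.
  - eapply AndE1; eauto.
  - eapply AndE2; eauto.
  - apply OrI1; auto.
  - apply OrI2; auto.
  - eapply OrE; eauto; [apply IHprv2 | apply IHprv3]; intros x [->|hx]; (now left) || (right; auto).
  - apply AllI, IHprv; now apply incl_map.
  - apply AllE; auto.
  - eapply ExI; eauto.
  - eapply ExE; eauto; apply IHprv2; intros x [->|hx]; [now left|right; now apply (incl_map _ hi)].
  - apply RAA, IHprv; intros x [->|hx]; [now left | right; auto].
  - apply EqI.
  - eapply EqE; eauto.
Qed.

Lemma prv_mono (T U : theory) (hTU : forall A, T A -> U A) G (H : list (fm G)) A :
  prv T H A -> prv U H A.
Proof.
  induction 1; [apply Ax; auto | now apply Hyp | apply ImpI | eapply ImpE | apply AndI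
    | eapply AndE1 | eapply AndE2 | apply OrI1 | apply OrI2 | eapply OrE | apply AllI
    | apply AllE | eapply ExI | eapply ExE | apply RAA | apply EqI | eapply EqE]; eauto.
Qed.

(** The quantifier rules and [EqE] go through because renaming commutes with weakening and with
    instantiation. *)
Lemma prv_ren T G (H : list (fm G)) A :
  prv T H A -> forall D (f : ren G D), prv T (map (fun B => ren_fm B f) H) (ren_fm A f).
Proof.
  induction 1; intros D f; simpl in *.
  - rewrite ren_embed; now apply Ax.
  - apply Hyp; now apply (in_map (fun B => ren_fm B f)).
  - apply ImpI; auto.
  - eapply ImpE; eauto.
  - apply AndI; auto.
  - eapply AndE1; eauto.
  - eapply AndE2; eauto.
  - apply OrI1; auto.
  - apply OrI2; auto.
  - eapply OrE; eauto.
  - apply AllI; rewrite <- map_ren_wk; auto.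
  - rewrite ren_inst; apply AllE; auto.
  - eapply ExI; rewrite <- ren_inst; auto.
  - eapply ExE; [now apply IHprv1|]. rewrite <- map_ren_wk, <- ren_wk; auto.
  - apply RAA; auto.
  - apply EqI.
  - rewrite ren_inst; eapply EqE; eauto; rewrite <- ren_inst; auto.
Qed.

Lemma prv_wk T G t (H : list (fm G)) A :
  prv T H A -> prv T (map (wk_fm (t := t)) H) (wk_fm A).
Proof. intro h; now apply (prv_ren h). Qed.

(** * Enumeration of formulas *)

(** Asking for all larger depths lets the bounds of subterms be combined by a maximum, without
    monotonicity of the enumerations. *)
Definition eventually (P : nat -> Prop) : Prop := exists d, forall d', d <= d' -> P d'.

Lemma eventually_and P Q : eventually P -> eventually Q -> eventually (fun d => P d /\ Q d).
Proof.
  intros [d h] [e k]; exists (Nat.max d e); intros d' hd; split.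
  - apply h; eapply Nat.le_trans; [apply Nat.le_max_l | apply hd].
  - apply k; eapply Nat.le_trans; [apply Nat.le_max_r | apply hd].
Qed.

Lemma eventually_S (P Q : nat -> Prop) :
  (forall d, P d -> Q (S d)) -> eventually P -> eventually Q.
Proof.
  intros hPQ [d h]; exists (S d); intros [|d'] hd; [inversion hd|].
  apply hPQ, h; now apply le_S_n.
Qed.

Definition ty_eq_dec (s t : ty) : {s = t} + {s <> t}.
Proof. decide equality. Defined.

Fixpoint tys (d : nat) : list ty :=
  match d with
  | 0 => []
  | S d => N :: map (fun p => fst p ~> snd p) (list_prod (tys d) (tys d))
  end.

Lemma tys_complete s : eventually (fun d => In s (tys d)).
Proof.
  induction s as [|s hs t ht].
  - exists 1; intros [|d] hd; [inversion hd | now left].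
  - eapply eventually_S; [|exact (eventually_and hs ht)]; intros d [h1 h2]; right.
    apply (in_map (fun p => fst p ~> snd p) _ (s, t)); now apply in_prod.
Qed.

Fixpoint vars (G : ctx) : list {s & var G s} :=
  match G with
  | [] => []
  | t :: G => existT (var (t :: G)) t vz :: map (fun p => existT _ (projT1 p) (vs (projT2 p))) (vars G)
  end.

Lemma vars_complete G s (x : var G s) : In (existT _ s x) (vars G).
Proof.
  induction x as [G s|G s t x IH]; simpl; [now left | right].
  now apply (in_map (fun p => existT (var (t :: G)) (projT1 p) (vs (projT2 p))) _ _ IH).
Qed.

Definition app_list G (p q : {s & tm G s}) : list {s & tm G s} :=
  match p with
  | existT _ s u =>
    match s return tm G s -> list {s & tm G s} with
    | N => fun _ => []
    | a ~> b => fun u =>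
        match q with
        | existT _ c v =>
          match ty_eq_dec c a with
          | left e => [existT _ b (App u (eq_rect c (tm G) v a e))]
          | right _ => []
          end
        end
    end u
  end.

Definition at_N G (p : {s & tm G s}) : list (tm G N) :=
  match p with
  | existT _ s u =>
    match s return tm G s -> list (tm G N) with
    | N => fun u => [u]
    | _ ~> _ => fun _ => []
    end u
  end.

Definition plain_consts G : list {s & tm G s} :=
  [existT _ _ Zero; existT _ _ One; existT _ _ Plus; existT _ _ Times; existT _ _ R0].

Fixpoint tms (d : nat) (G : ctx) : list {s & tm G s} :=
  match d with
  | 0 => []
  | S d =>
      map (fun p => existT (tm G) (projT1 p) (Var (projT2 p))) (vars G)
      ++ plain_consts G
      ++ flat_map (fun r => map (fun s => existT (tm G) _ (Kc r s)) (tys d)) (tys d)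
      ++ flat_map (fun r => flat_map (fun s => map (fun t => existT (tm G) _ (Sc r s t)) (tys d))
           (tys d)) (tys d)
      ++ flat_map (fun p => flat_map (app_list p) (tms d G)) (tms d G)
  end.

(** One depth has to serve all renamings at once, because the Henkin construction meets an
    expression again in larger contexts. It exists because [tms] lists all variables of the context
    from depth [1] on. *)
Lemma tms_complete G s (u : tm G s) :
  eventually (fun d => forall D (f : ren G D), In (existT _ s (ren_tm f u)) (tms d D)).
Proof.
  assert (hc : forall p : forall D, {s & tm D s}, (forall D, In (p D) (plain_consts D)) ->
    eventually (fun d => forall D (f : ren G D), In (p D) (tms d D))).
  { intros p hp; exists 1; intros [|d] hd; [inversion hd | intros D f].
    apply in_app_iff; right; apply in_app_iff; left; apply hp. }
  induction u as [s x|s t u hu v hv| | | | |r s|r s t|]; simpl.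
  - exists 1; intros [|d] hd; [inversion hd | intros D f; apply in_app_iff; left].
    apply (in_map (fun p => existT (tm D) (projT1 p) (Var (projT2 p))) _ (existT _ s (f s x))).
    apply vars_complete.
  - eapply eventually_S; [|exact (eventually_and hu hv)]; intros d [h1 h2] D f.
    cbn [tms]; rewrite !in_app_iff; do 4 right.
    apply in_flat_map; exists (existT _ _ (ren_tm f u)); split; [apply h1|].
    apply in_flat_map; exists (existT _ _ (ren_tm f v)); split; [apply h2|].
    simpl; destruct (ty_eq_dec s s) as [e|n]; [|now destruct n].
    (* The cast runs along a proof of [s = s], hence is the identity. *)
    rewrite <- eq_rect_eq; now left.
  - apply (hc (fun D => existT _ _ Zero)); intro; simpl; auto.
  - apply (hc (fun D => existT _ _ One)); intro; simpl; auto.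
  - apply (hc (fun D => existT _ _ Plus)); intro; simpl; auto.
  - apply (hc (fun D => existT _ _ Times)); intro; simpl; auto.
  - eapply eventually_S; [|exact (eventually_and (tys_complete r) (tys_complete s))].
    intros d [h1 h2] D f; cbn [tms]; rewrite !in_app_iff; do 2 right; left.
    apply in_flat_map; exists r; split; [easy|].
    now apply (in_map (fun s => existT (tm D) _ (Kc r s))).
  - eapply eventually_S;
      [|exact (eventually_and (tys_complete r) (eventually_and (tys_complete s) (tys_complete t)))].
    intros d [h1 [h2 h3]] D f; cbn [tms]; rewrite !in_app_iff; do 3 right; left.
    apply in_flat_map; exists r; split; [easy|].
    apply in_flat_map; exists s; split; [easy|].
    now apply (in_map (fun t => existT (tm D) _ (Sc r s t))).
  - apply (hc (fun D => existT _ _ R0)); intro; simpl; auto 6.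
Qed.

Definition tms_N d G : list (tm G N) := flat_map (@at_N G) (tms d G).

Lemma tms_N_complete G (u : tm G N) :
  eventually (fun d => forall D (f : ren G D), In (ren_tm f u) (tms_N d D)).
Proof.
  destruct (tms_complete u) as [d h]; exists d; intros d' hd D f.
  apply in_flat_map; exists (existT _ _ (ren_tm f u)); split; [now apply h | now left].
Qed.

Definition map2 {X Y} (f : X -> X -> Y) (l : list X) : list Y :=
  map (fun p => f (fst p) (snd p)) (list_prod l l).

Lemma in_map2 {X Y} (f : X -> X -> Y) l x y : In x l -> In y l -> In (f x y) (map2 f l).
Proof.
  intros hx hy; apply (in_map (fun p => f (fst p) (snd p)) _ (x, y)); now apply in_prod.
Qed.

Fixpoint fms (d : nat) (G : ctx) : list (fm G) :=
  match d with
  | 0 => []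
  | S d =>
      map2 (@Eqn G) (tms_N d G) ++ map2 (@Less G) (tms_N d G) ++ [Bot]
      ++ map2 (@Imp G) (fms d G) ++ map2 (@And G) (fms d G) ++ map2 (@Or G) (fms d G)
      ++ flat_map (fun t => map (All t) (fms d (t :: G))) (tys d)
      ++ flat_map (fun t => map (Ex t) (fms d (t :: G))) (tys d)
  end.

Lemma fms_complete G (A : fm G) :
  eventually (fun d => forall D (f : ren G D), In (ren_fm A f) (fms d D)).
Proof.
  induction A as [G u v|G u v| |G A hA B hB|G A hA B hB|G A hA B hB|G t A hA|G t A hA].
  - eapply eventually_S; [|exact (eventually_and (tms_N_complete u) (tms_N_complete v))].
    intros d [h1 h2] D f; cbn [fms ren_fm]; rewrite !in_app_iff; left; now apply in_map2.
  - eapply eventually_S; [|exact (eventually_and (tms_N_complete u) (tms_N_complete v))].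
    intros d [h1 h2] D f; cbn [fms ren_fm]; rewrite !in_app_iff; right; left; now apply in_map2.
  - exists 1; intros [|d] hd; [inversion hd | intros D f; cbn [fms ren_fm]; rewrite !in_app_iff].
    do 2 right; left; now left.
  - eapply eventually_S; [|exact (eventually_and hA hB)]; intros d [h1 h2] D f;
      cbn [fms ren_fm]; rewrite !in_app_iff; do 3 right; left; now apply in_map2.
  - eapply eventually_S; [|exact (eventually_and hA hB)]; intros d [h1 h2] D f;
      cbn [fms ren_fm]; rewrite !in_app_iff; do 4 right; left; now apply in_map2.
  - eapply eventually_S; [|exact (eventually_and hA hB)]; intros d [h1 h2] D f;
      cbn [fms ren_fm]; rewrite !in_app_iff; do 5 right; left; now apply in_map2.
  - eapply eventually_S; [|exact (eventually_and hA (tys_complete t))]; intros d [h1 h2] D f;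
      cbn [fms ren_fm]; rewrite !in_app_iff; do 6 right; left.
    apply in_flat_map; exists t; split; [easy | now apply in_map].
  - eapply eventually_S; [|exact (eventually_and hA (tys_complete t))]; intros d [h1 h2] D f;
      cbn [fms ren_fm]; rewrite !in_app_iff; do 7 right.
    apply in_flat_map; exists t; split; [easy | now apply in_map].
Qed.

(** * Provable equality, models, and stages *)

Lemma sub_wk {G t s} (u : tm G t) (w : tm G s) : sub_tm (scons_var (tm G) u (@Var G)) (wk w) = w.
Proof. unfold wk; rewrite sub_ren_tm; apply sub_id_tm. Qed.

Lemma sub_up_wk {G D t s} (f : sub G D) (w : tm G s) :
  sub_tm (up (t := t) f) (wk w) = wk (sub_tm f w).
Proof. unfold wk; now rewrite sub_ren_tm, ren_sub_tm. Qed.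

Lemma ren_eq_at s : forall G D (f : ren G D) (u v : tm G s),
  ren_fm (eq_at u v) f = eq_at (ren_tm f u) (ren_tm f v).
Proof.
  induction s as [|s _ t IH]; intros G D f u v; simpl; [reflexivity|].
  rewrite IH; simpl; unfold wk; now rewrite !ren_ren_tm.
Qed.

Lemma sub_eq_at s : forall G D (f : sub G D) (u v : tm G s),
  sub_fm (eq_at u v) f = eq_at (sub_tm f u) (sub_tm f v).
Proof.
  induction s as [|s _ t IH]; intros G D f u v; simpl; [reflexivity|].
  rewrite IH; simpl; unfold wk; now rewrite !sub_ren_tm, !ren_sub_tm.
Qed.

Section Provability.
Context (T : theory).

(** Induction on [L]: its members are discharged one by one as implications. *)
Lemma prv_cut G (L : list (fm G)) : forall C H,
  prv T L C -> (forall B, In B L -> prv T H B) -> prv T H C.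
Proof.
  induction L as [|B L IH]; intros C H h hL.
  - apply (prv_weaken h); now intros x [].
  - apply ImpE with B; [|apply hL; now left].
    apply IH; [now apply ImpI | intros; apply hL; now right].
Qed.

Lemma prv_eq_refl s : forall G (H : list (fm G)) (u : tm G s), prv T H (eq_at u u).
Proof.
  induction s as [|s _ t IH]; intros G H u; [apply EqI | apply AllI, IH].
Qed.

Lemma prv_eq_app1 G (H : list (fm G)) s t (f g : tm G (s ~> t)) x :
  prv T H (eq_at f g) -> prv T H (eq_at (f @ x) (g @ x)).
Proof.
  intro h; apply (fun h => AllE x h) in h; unfold inst in h; rewrite sub_eq_at in h.
  simpl in h; now rewrite !sub_wk in h.
Qed.

Lemma prv_eq_sym s : forall G (H : list (fm G)) (u v : tm G s),
  prv T H (eq_at u v) -> prv T H (eq_at v u).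
Proof.
  induction s as [|s _ t IH]; intros G H u v h.
  - assert (e : inst (v0 [=] wk u) v = eq_at v u) by (unfold inst; simpl; now rewrite sub_wk).
    rewrite <- e; apply EqE with u; [exact h|].
    unfold inst; simpl; rewrite sub_wk; apply EqI.
  - apply AllI, IH, prv_eq_app1; unfold wk; rewrite <- ren_eq_at; now apply prv_wk.
Qed.

Lemma prv_eq_trans s : forall G (H : list (fm G)) (u v w : tm G s),
  prv T H (eq_at u v) -> prv T H (eq_at v w) -> prv T H (eq_at u w).
Proof.
  induction s as [|s _ t IH]; intros G H u v w h k.
  - assert (e : forall w, inst (wk u [=] v0) w = eq_at u w)
      by (intro; unfold inst; simpl; now rewrite sub_wk).
    rewrite <- e; apply EqE with v; [exact k | now rewrite e].
  - apply AllI; eapply IH; apply prv_eq_app1; unfold wk; rewrite <- ren_eq_at;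
      apply prv_wk; eassumption.
Qed.

Lemma prv_less G (H : list (fm G)) (u u' v v' : tm G N) :
  prv T H (u [=] u') -> prv T H (v [=] v') -> prv T H (u [<] v) -> prv T H (u' [<] v').
Proof.
  intros hu hv h.
  assert (e : forall w, inst (wk u [<] v0) w = (u [<] w))
    by (intro; unfold inst; simpl; now rewrite sub_wk).
  assert (e' : forall w, inst (v0 [<] wk v') w = (w [<] v'))
    by (intro; unfold inst; simpl; now rewrite sub_wk).
  rewrite <- e'; apply EqE with u; [exact hu|]; rewrite e', <- e.
  apply EqE with v; [exact hv | now rewrite e].
Qed.

(** Changing the function is pointwise equality at [x]; changing the argument is the extensionality
    axiom. *)
Lemma prv_ext (hT : forall A, RCA0w A -> T A) G (H : list (fm G)) s t (f g : tm G (s ~> t)) x y :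
  prv T H (eq_at f g) -> prv T H (eq_at x y) -> prv T H (eq_at (f @ x) (g @ y)).
Proof.
  intros hf hx; apply prv_eq_trans with (g @ x); [now apply prv_eq_app1|].
  eapply ImpE; [|exact hx].
  pose proof (Ax (G := G) T H _ (hT _ (rca_ext s t))) as h; unfold embed in h.
  cbn [close ren_fm] in h; rewrite !ren_eq_at in h.
  apply (fun h => AllE g h) in h; unfold inst in h; cbn [sub_fm] in h.
  apply (fun h => AllE x h) in h; unfold inst in h; cbn [sub_fm] in h.
  apply (fun h => AllE y h) in h; unfold inst in h; cbn [sub_fm] in h.
  rewrite !sub_eq_at in h; simpl in h; rewrite !sub_wk, !sub_up_wk, !sub_wk in h.
  exact h.
Qed.

End Provability.

(** The domains of higher type are arbitrary sets with an application map, not full function spaces.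
    By [ap_ext], [eq_at] is interpreted as identity at every type. *)
Record model := {
  dom :> ty -> Type;
  ap : forall s t, dom (s ~> t) -> dom s -> dom t;
  m_zero : dom N;
  m_one : dom N;
  m_plus : dom (N ~> N ~> N);
  m_times : dom (N ~> N ~> N);
  m_K : forall r s, dom (r ~> s ~> r);
  m_S : forall r s t, dom ((r ~> s ~> t) ~> (r ~> s) ~> r ~> t);
  m_R : dom (ty1 ~> N ~> N ~> N);
  m_lt : dom N -> dom N -> Prop;
  ap_ext : forall s t (f g : dom (s ~> t)), (forall x, ap f x = ap g x) -> f = g
}.
Arguments ap {m s t} f x.
Arguments m_zero {m}.
Arguments m_one {m}.
Arguments m_plus {m}.
Arguments m_times {m}.
Arguments m_K {m}.
Arguments m_S {m}.
Arguments m_R {m}.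

Definition env (M : model) (G : ctx) := forall s, var G s -> M s.

Fixpoint eval (M : model) G s (r : env M G) (u : tm G s) : M s :=
  match u with
  | Var x => r _ x
  | App u v => ap (eval r u) (eval r v)
  | Zero => m_zero
  | One => m_one
  | Plus => m_plus
  | Times => m_times
  | Kc r s => m_K r s
  | Sc r s t => m_S r s t
  | R0 => m_R
  end.

Fixpoint sat (M : model) G (A : fm G) : env M G -> Prop :=
  match A with
  | Eqn u v => fun r => eval r u = eval r v
  | Less u v => fun r => m_lt M (eval r u) (eval r v)
  | Bot => fun _ => False
  | Imp A B => fun r => sat A r -> sat B r
  | And A B => fun r => sat A r /\ sat B r
  | Or A B => fun r => sat A r \/ sat B r
  | All t A => fun r => forall a : M t, sat A (scons_var M a r)
  | Ex t A => fun r => exists a : M t, sat A (scons_var M a r)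
  end.

Definition env_nil (M : model) : env M [] := fun s x => False_rect _ (var_nil x).

Definition holds (M : model) (A : sentence) : Prop := sat A (env_nil M).

(** * Stages of the Henkin construction *)

Record stage := Stage { s_ctx : ctx; s_hyps : list (fm s_ctx); s_queue : list (fm s_ctx) }.

Definition wit_ty G (A : fm G) : ty := match A with Ex t _ => t | _ => N end.

(** Since the fresh variable has index [0], the body of an existential formula, read in the extended
    context, is already its witnessing instance. *)
Definition wit G (A : fm G) : list (fm (wit_ty A :: G)) :=
  match A as A' in fm G' return list (fm (wit_ty A' :: G')) with
  | @Ex G' t B => [B]
  | _ => []
  end.

Definition next_ty G (Q : list (fm G)) : ty :=
  match Q with [] => N | A :: _ => wit_ty A end.

(** A [Type]-valued order, so that renamings between stages can be defined by recursion on it. *)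
Inductive later (n : nat) : nat -> Type :=
| later_refl : later n n
| later_S : forall m, later n m -> later n (S m).
Arguments later_refl {n}.

Fixpoint later_trans n m k (p : later n m) (q : later m k) : later n k :=
  match q with
  | later_refl => p
  | later_S q => later_S (later_trans p q)
  end.

Fixpoint later_add k n : later n (k + n) :=
  match k with
  | 0 => later_refl
  | S k => later_S (later_add k n)
  end.

Lemma later_le n m : later n m -> n <= m.
Proof. induction 1; auto. Qed.

(** Makes the passage from one stage to another independent of the route, so that lifts through
    different intermediate stages agree. *)
Lemma later_unique n m (p q : later n m) : p = q.
Proof.
  induction p as [|m p IH]; dependent destruction q; trivial.
  - pose proof (later_le q) as h; now apply Nat.nle_succ_diag_l in h.
  - exfalso; pose proof (later_le p) as h; now apply Nat.nle_succ_diag_l in h.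
  - f_equal; apply IH.
Qed.

Lemma later_directed n m : exists N (p : later n N) (q : later m N), True.
Proof.
  exists (m + n), (later_add m n); rewrite Nat.add_comm; now exists (later_add n m).
Qed.

(** * Henkin completeness *)

Section Henkin.
Context (T : theory) (hT : forall A, RCA0w A -> T A).
Context (A0 : sentence) (hA0 : ~ proves T A0).

Definition consistent G (H : list (fm G)) : Prop := ~ prv T H Bot.

(** Each stage adds one variable to the context: a witness if the head of the queue is an
    existential formula consistent with the hypotheses, a dummy variable otherwise. *)
Definition next_hyps G (H Q : list (fm G)) : list (fm (next_ty Q :: G)) :=
  match Q with
  | [] => map wk_fm H
  | A :: _ =>
      if excluded_middle_informative (consistent (A :: H))
      then wit A ++ map wk_fm (A :: H) else map wk_fm H
  end.

(** The queue is first in, first out: the head is dropped and the formulas of depth bound [n] over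
    the current context join the end, so every formula has its turn. *)
Definition next_stage (n : nat) (S : stage) : stage :=
  Stage (next_hyps (s_hyps S) (s_queue S)) (map wk_fm (tl (s_queue S) ++ fms n (s_ctx S))).

Fixpoint st (n : nat) : stage :=
  match n with
  | 0 => @Stage [] [Imp A0 Bot] []
  | S n => next_stage n (st n)
  end.

Notation ctx_at n := (s_ctx (st n)).
Notation hyps n := (s_hyps (st n)).

Fixpoint lift n m (p : later n m) : ren (ctx_at n) (ctx_at m) :=
  match p with
  | later_refl => fun _ x => x
  | later_S q => fun s x => vs (lift q x)
  end.

Lemma lift_trans n m k (p : later n m) (q : later m k) s (x : var (ctx_at n) s) :
  lift (later_trans p q) x = lift q (lift p x).
Proof. induction q as [|k q IH]; simpl; congruence. Qed.

Lemma ren_lift_trans n m k (p : later n m) (q : later m k) (A : fm (ctx_at n)) :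
  ren_fm A (lift (later_trans p q)) = ren_fm (ren_fm A (lift p)) (lift q).
Proof.
  rewrite ren_ren_fm; f_equal; do 2 (apply functional_extensionality_dep; intro); apply lift_trans.
Qed.

Lemma lift_S_fm n m (p : later n m) (A : fm (ctx_at n)) :
  wk_fm (ren_fm A (lift p)) = ren_fm A (lift (later_S p)) :> fm (ctx_at (S m)).
Proof. exact (ren_ren_fm A (lift p) (@shift (ctx_at m) (next_ty (s_queue (st m))))). Qed.

Lemma ren_tm_lift_trans n m k (p : later n m) (q : later m k) s (u : tm (ctx_at n) s) :
  ren_tm (lift (later_trans p q)) u = ren_tm (lift q) (ren_tm (lift p) u).
Proof.
  rewrite ren_ren_tm; f_equal; do 2 (apply functional_extensionality_dep; intro); apply lift_trans.
Qed.

(** A fresh variable does no harm because every type is inhabited: a derivation of [Bot] is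
    generalised and then instantiated at the constant [one_at t]. *)
Lemma consistent_wk G t (H : list (fm G)) : consistent H -> consistent (map (wk_fm (t := t)) H).
Proof. intros hH h; apply hH; apply (AllE (A := Bot) (one_at t)), AllI, h. Qed.

(** If the witnessing instance were contradictory, [ExE] would refute the existential formula
    itself. *)
Lemma consistent_wit G (H : list (fm G)) A :
  consistent (A :: H) -> consistent (wit A ++ map wk_fm (A :: H)).
Proof.
  destruct A; try apply (consistent_wk (t := N)).
  intros hH h; apply hH; eapply ExE; [apply Hyp; now left | exact h].
Qed.

Lemma consistent_next G (H Q : list (fm G)) : consistent H -> consistent (next_hyps H Q).
Proof.
  intro hH; destruct Q as [|A Q]; simpl; [now apply consistent_wk|].
  destruct excluded_middle_informative; [now apply consistent_wit | now apply consistent_wk].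
Qed.

Lemma consistent_st n : consistent (hyps n).
Proof.
  induction n as [|n IH]; [|now apply consistent_next].
  intro h; apply hA0; now apply RAA.
Qed.

Lemma next_hyps_incl G (H Q : list (fm G)) : incl (map wk_fm H) (next_hyps H Q).
Proof.
  destruct Q as [|A Q]; simpl; [apply incl_refl|].
  destruct excluded_middle_informative; [|apply incl_refl].
  apply incl_appr, incl_tl, incl_refl.
Qed.

Lemma head_kept G (H Q Q' : list (fm G)) A :
  Q = A :: Q' -> consistent (A :: H) -> In (wk_fm A) (next_hyps H Q).
Proof.
  intros -> h; simpl; destruct excluded_middle_informative as [_|e]; [|now destruct e].
  apply in_or_app; right; now left.
Qed.

Lemma prv_lift n m (p : later n m) A : prv T (hyps n) A -> prv T (hyps m) (ren_fm A (lift p)).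
Proof.
  intro h; induction p as [|m p IH]; [simpl; now rewrite ren_id_fm|].
  rewrite <- lift_S_fm.
  eapply prv_weaken; [exact (prv_wk _ IH) | apply next_hyps_incl].
Qed.

(** The limit theory, seen from stage [n]. *)
Definition Th n (A : fm (ctx_at n)) : Prop :=
  exists m (p : later n m), prv T (hyps m) (ren_fm A (lift p)).

Lemma Th_lift n m (p : later n m) A : Th m (ren_fm A (lift p)) <-> Th n A.
Proof.
  split.
  - intros [k [q h]]; exists k, (later_trans p q); now rewrite ren_lift_trans.
  - intros [k [q h]]; destruct (later_directed m k) as [N [p' [q' _]]].
    exists N, p'; rewrite <- ren_lift_trans.
    rewrite (later_unique (later_trans p p') (later_trans q q')), ren_lift_trans; now apply prv_lift.
Qed.

(** The stages are directed and provability lifts, so finitely many members hold at a common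
    stage. *)
Lemma Th_list n (L : list (fm (ctx_at n))) : (forall B, In B L -> Th n B) ->
  exists m (p : later n m), forall B, In B L -> prv T (hyps m) (ren_fm B (lift p)).
Proof.
  induction L as [|A L IH]; intro hL.
  - exists n, later_refl; intros B [].
  - destruct IH as [m [p h]]; [intros; apply hL; now right|].
    destruct (hL A) as [k [q hA]]; [now left|].
    destruct (later_directed m k) as [N [p' [q' _]]]; exists N, (later_trans p p').
    intros B [<-|hB].
    + rewrite (later_unique (later_trans p p') (later_trans q q')), ren_lift_trans; now apply prv_lift.
    + rewrite ren_lift_trans; now apply prv_lift, h.
Qed.

Lemma Th_prv n (L : list (fm (ctx_at n))) A : (forall B, In B L -> Th n B) -> prv T L A -> Th n A.
Proof.
  intros hL hA; destruct (Th_list L hL) as [m [p h]]; exists m, p.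
  eapply prv_cut; [exact (prv_ren hA (lift p))|].
  intros B hB; apply in_map_iff in hB as [C [<- hC]]; auto.
Qed.

(** The premise has the shape of an inference rule, so rules of the calculus can be supplied to it
    directly. *)
Lemma Th_prv1 n (A B : fm (ctx_at n)) : (prv T [A] A -> prv T [A] B) -> Th n A -> Th n B.
Proof.
  intros h hA; apply (Th_prv (L := [A])); [now intros C [<-|[]] | apply h, Hyp; now left].
Qed.

Lemma Th_prv2 n (A B C : fm (ctx_at n)) :
  (prv T [A; B] A -> prv T [A; B] B -> prv T [A; B] C) -> Th n A -> Th n B -> Th n C.
Proof.
  intros h hA hB; apply (Th_prv (L := [A; B]));
    [now intros D [<-|[<-|[]]] | apply h; apply Hyp; simpl; auto].
Qed.

Lemma Th_Bot n : ~ Th n Bot.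
Proof. intros [m [p h]]; exact (consistent_st m h). Qed.

(** Induction on the number [k] of formulas ahead of [A], since each stage removes one. *)
Lemma queue_head k : forall n l1 A l2, s_queue (st n) = l1 ++ A :: l2 -> length l1 = k ->
  exists m (p : later n m) Q, s_queue (st m) = ren_fm A (lift p) :: Q.
Proof.
  induction k as [|k IH]; intros n [|B l1] A l2 hq hk; try discriminate.
  - exists n, later_refl, l2; simpl; now rewrite ren_id_fm.
  - destruct (IH (S n) (map wk_fm l1) (wk_fm A) (map wk_fm (l2 ++ fms n (ctx_at n)))) as [m [p [Q h]]].
    + assert (e : tl (s_queue (st n)) ++ fms n (ctx_at n) = l1 ++ A :: l2 ++ fms n (ctx_at n))
        by (rewrite hq; simpl; now rewrite <- app_assoc).
      cbn [st next_stage s_queue]; rewrite e; apply map_app.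
    + rewrite length_map; now injection hk.
    + exists m, (later_trans (later_S later_refl) p), Q; rewrite h, ren_lift_trans; reflexivity.
Qed.

Lemma processed n (A : fm (ctx_at n)) :
  exists m (p : later n m) Q, s_queue (st m) = ren_fm A (lift p) :: Q.
Proof.
  destruct (fms_complete A) as [d hd].
  set (p := later_add d n).
  (* The bound [d] is independent of the context, so the lift of [A] is among the formulas appended
     at stage [d + n]. *)
  assert (h : In (ren_fm A (lift (later_S p))) (s_queue (st (S (d + n))))).
  { rewrite <- lift_S_fm; apply in_map, in_or_app; right; apply hd, Nat.le_add_r. }
  apply in_split in h as [l1 [l2 h]].
  destruct (queue_head (S (d + n)) _ _ _ h eq_refl) as [m [q [Q hq]]].
  exists m, (later_trans (later_S p) q), Q; now rewrite hq, ren_lift_trans.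
Qed.

(** When [A] reaches the head of the queue, it is either consistent with the hypotheses and added,
    or refuted by them. *)
Lemma Th_complete n (A : fm (ctx_at n)) : Th n A \/ Th n (Imp A Bot).
Proof.
  destruct (processed n A) as [m [p [Q hq]]].
  destruct (excluded_middle_informative (consistent (ren_fm A (lift p) :: hyps m))) as [h|h].
  - left; exists (S m), (later_S p); rewrite <- lift_S_fm; apply Hyp; eapply head_kept; eassumption.
  - right; exists m, p; simpl; apply ImpI, NNPP, h.
Qed.

(** The stage is arbitrary, so that it can be destructed: the type of the next context depends on
    the queue being rewritten. *)
Lemma step_witness n (S : stage) t (B : fm (t :: s_ctx S)) Q : s_queue S = Ex t B :: Q -> consistent (Ex t B :: s_hyps S) ->
  exists u : tm (s_ctx (next_stage n S)) t, prv T (s_hyps (next_stage n S))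
    (inst (ren_fm B (up_ren (@shift (s_ctx S) (next_ty (s_queue S))))) u).
Proof.
  destruct S as [G H Q']; simpl in *; intros -> h; simpl.
  destruct excluded_middle_informative as [_|e]; [|now destruct e].
  exists v0; rewrite inst_var0; apply Hyp; now left.
Qed.

Lemma Th_Ex n t (B : fm (t :: ctx_at n)) : Th n (Ex t B) ->
  exists m (p : later n m) u, Th m (inst (ren_fm B (up_ren (lift p))) u).
Proof.
  intro hE; destruct (processed n (Ex t B)) as [m [p [Q hq]]].
  destruct (step_witness m (st m) hq) as [u hu].
  (* The existential formula passes the consistency test because it lies in the theory: a refutation
     would put its negation there too. *)
  { intro h; apply (Th_Bot (n := m)).
    apply (Th_prv2 (A := ren_fm (Ex t B) (lift p)) (B := Imp (ren_fm (Ex t B) (lift p)) Bot)).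
    - intros h1 h2; now apply ImpE with (ren_fm (Ex t B) (lift p)).
    - now rewrite Th_lift.
    - exists m, later_refl; rewrite ren_id_fm; now apply ImpI. }
  exists (S m), (later_S p), u, (S m), later_refl; rewrite ren_id_fm.
  rewrite ren_ren_fm in hu; eapply eq_ind; [exact hu|]; do 2 f_equal.
  now apply (var_fun_ext (var _)).
Qed.

Lemma Th_ExI n m (p : later n m) t (B : fm (t :: ctx_at n)) u :
  Th m (inst (ren_fm B (up_ren (lift p))) u) -> Th n (Ex t B).
Proof.
  intro h; rewrite <- (Th_lift p); simpl; revert h; apply Th_prv1; apply ExI.
Qed.

Lemma Th_AllE n m (p : later n m) t (B : fm (t :: ctx_at n)) u :
  Th n (All t B) -> Th m (inst (ren_fm B (up_ren (lift p))) u).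
Proof.
  rewrite <- (Th_lift p); simpl; apply Th_prv1; apply AllE.
Qed.

(** By completeness: if the theory claims a counterexample, it has a witness that contradicts an
    instance; if it denies one, [RAA] gives the universal formula. *)
Lemma Th_All n t (B : fm (t :: ctx_at n)) :
  (forall m (p : later n m) u, Th m (inst (ren_fm B (up_ren (lift p))) u)) -> Th n (All t B).
Proof.
  intro h; destruct (Th_complete n (Ex t (Imp B Bot))) as [hE|hE].
  - destruct (Th_Ex hE) as [m [p [u hu]]]; destruct (Th_Bot (n := m)).
    generalize hu (h m p u); apply Th_prv2; intros h1 h2; exact (ImpE h1 h2).
  - revert hE; apply Th_prv1; intro hE; apply AllI, RAA.
    eapply ImpE; [eapply prv_weaken; [exact (prv_wk t hE)|]; now apply incl_tl|].
    apply ExI with v0.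
    match goal with |- prv _ _ ?X => replace X with (Imp B Bot) end; [apply Hyp; now left|].
    symmetry; exact (inst_var0 (Imp B Bot)).
Qed.

(** The domain at type [s] consists of the terms of all stages modulo [eq_at], which is a
    congruence by the extensionality axioms; so the term model is extensional. *)
Definition cls s n (u : tm (ctx_at n) s) : {n & tm (ctx_at n) s} -> Prop :=
  fun b => exists m (p : later n m) (q : later (projT1 b) m),
    Th m (eq_at (ren_tm (lift p) u) (ren_tm (lift q) (projT2 b))).

Definition cls_dom s := {P : {n & tm (ctx_at n) s} -> Prop | exists n u, P = cls n u}.

Definition in_cls s n (u : tm (ctx_at n) s) : cls_dom s :=
  exist _ (cls n u) (ex_intro _ n (ex_intro _ u eq_refl)).

Lemma in_cls_eq s n (u v : tm (ctx_at n) s) : in_cls n u = in_cls n v <-> Th n (eq_at u v).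
Proof.
  split.
  - intro h; apply (f_equal (fun c => proj1_sig c (existT (fun n => tm (ctx_at n) s) n v))) in h.
    simpl in h.
    (* By reflexivity [v] lies in its own class, hence also in that of [u]. *)
    assert (hv : cls n v (existT (fun n => tm (ctx_at n) s) n v)).
    { exists n, later_refl, later_refl, n, later_refl; rewrite ren_eq_at; apply prv_eq_refl. }
    rewrite <- h in hv; destruct hv as [m [p [q hv]]]; simpl in q, hv.
    rewrite (later_unique q p), <- ren_eq_at in hv; revert hv; apply Th_lift.
  - intro h; apply eq_sig_hprop; [intros; apply proof_irrelevance|]; simpl.
    apply functional_extensionality; intros [k w]; apply propositional_extensionality.
    split; intros [m [p [q hw]]]; exists m, p, q; simpl in *;
      rewrite <- (Th_lift p), ren_eq_at in h; generalize h hw; apply Th_prv2; intros h1 h2.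
    + eapply prv_eq_trans; [apply prv_eq_sym; exact h1 | exact h2].
    + eapply prv_eq_trans; [exact h1 | exact h2].
Qed.

Lemma in_cls_lift s n m (p : later n m) (u : tm (ctx_at n) s) :
  in_cls m (ren_tm (lift p) u) = in_cls n u.
Proof.
  apply eq_sig_hprop; [intros; apply proof_irrelevance|]; simpl.
  apply functional_extensionality; intros [k w]; apply propositional_extensionality.
  split; intros [N [q [r h]]]; simpl in *.
  - exists N, (later_trans p q), r; now rewrite ren_tm_lift_trans.
  - destruct (later_directed m N) as [N' [p' [q' _]]].
    exists N', p', (later_trans r q'); rewrite <- !ren_tm_lift_trans.
    rewrite (later_unique (later_trans p p') (later_trans q q')); simpl.
    rewrite !ren_tm_lift_trans, <- ren_eq_at; now apply Th_lift.
Qed.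

Lemma cls_dom_rep s (c : cls_dom s) : exists n u, c = in_cls n u.
Proof.
  destruct c as [P [n [u e]]]; exists n, u; subst P; reflexivity.
Qed.

(** A relation first, because function and argument need representatives at a common stage;
    [cls_app_in] shows that their choice does not matter. *)
Definition app_graph s t (f : cls_dom (s ~> t)) (x : cls_dom s) (y : cls_dom t) : Prop :=
  exists n u v, f = in_cls n u /\ x = in_cls n v /\ y = in_cls n (u @ v).

Lemma app_graph_total s t (f : cls_dom (s ~> t)) (x : cls_dom s) : exists y, app_graph f x y.
Proof.
  destruct (cls_dom_rep f) as [n [u ->]], (cls_dom_rep x) as [m [v ->]].
  destruct (later_directed n m) as [N [p [q _]]].
  exists (in_cls N (ren_tm (lift p) u @ ren_tm (lift q) v)), N, (ren_tm (lift p) u), (ren_tm (lift q) v).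
  now rewrite !in_cls_lift.
Qed.

Definition cls_app s t (f : cls_dom (s ~> t)) (x : cls_dom s) : cls_dom t :=
  proj1_sig (constructive_indefinite_description _ (app_graph_total f x)).

Lemma cls_app_in s t n (u : tm (ctx_at n) (s ~> t)) v :
  cls_app (in_cls n u) (in_cls n v) = in_cls n (u @ v).
Proof.
  unfold cls_app; destruct constructive_indefinite_description as [y [m [u' [v' [hu [hv ->]]]]]]; simpl.
  destruct (later_directed n m) as [N [p [q _]]].
  rewrite <- (in_cls_lift p u), <- (in_cls_lift q u') in hu.
  rewrite <- (in_cls_lift p v), <- (in_cls_lift q v') in hv.
  rewrite <- (in_cls_lift p), <- (in_cls_lift q); apply in_cls_eq in hu, hv; apply in_cls_eq.
  generalize hu hv; apply Th_prv2; intros h1 h2; simpl.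
  apply prv_eq_sym; now apply prv_ext.
Qed.

(** Equality at an arrow type is a universal formula, and [Th_All] reduces it to the terms of later
    stages, whose classes are possible arguments. *)
Lemma cls_app_ext s t (f g : cls_dom (s ~> t)) : (forall x, cls_app f x = cls_app g x) -> f = g.
Proof.
  destruct (cls_dom_rep f) as [n [u ->]], (cls_dom_rep g) as [m [v ->]].
  destruct (later_directed n m) as [N [p [q _]]].
  rewrite <- (in_cls_lift p u), <- (in_cls_lift q v); intro h; apply in_cls_eq.
  apply Th_All; intros k r w; unfold inst; rewrite ren_eq_at, sub_eq_at; simpl.
  rewrite <- (in_cls_lift r), <- (in_cls_lift r (ren_tm (lift q) v)) in h.
  specialize (h (in_cls k w)); rewrite !cls_app_in in h; apply in_cls_eq in h.
  assert (e : forall x : tm (ctx_at N) (s ~> t),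
    sub_tm (scons_var _ w (@Var _)) (ren_tm (up_ren (lift r)) (wk x)) = ren_tm (lift r) x).
  { intro x; unfold wk; rewrite ren_ren_tm, sub_ren_tm, ren_tm_sub; reflexivity. }
  now rewrite !e.
Qed.

Definition cls_lt (c d : cls_dom N) : Prop :=
  exists n u v, c = in_cls n u /\ d = in_cls n v /\ Th n (u [<] v).

Lemma cls_lt_in n (u v : tm (ctx_at n) N) : cls_lt (in_cls n u) (in_cls n v) <-> Th n (u [<] v).
Proof.
  split; [|intro h; now exists n, u, v].
  intros [m [u' [v' [hu [hv h]]]]].
  destruct (later_directed n m) as [N [p [q _]]].
  rewrite <- (in_cls_lift p u), <- (in_cls_lift q u') in hu.
  rewrite <- (in_cls_lift p v), <- (in_cls_lift q v') in hv.
  apply in_cls_eq in hu, hv; rewrite <- (Th_lift q) in h; rewrite <- (Th_lift p).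
  assert (hL : forall B, In B [eq_at (ren_tm (lift p) u) (ren_tm (lift q) u');
      eq_at (ren_tm (lift p) v) (ren_tm (lift q) v'); ren_fm (u' [<] v') (lift q)] -> Th N B)
    by (now intros B [<-|[<-|[<-|[]]]]).
  apply (Th_prv hL); simpl.
  eapply prv_less; [apply (prv_eq_sym (s := Defs.N)) | apply (prv_eq_sym (s := Defs.N)) |]; apply Hyp; simpl; auto.
Qed.

Definition term_model : model := {|
  dom := cls_dom;
  ap := cls_app;
  m_zero := in_cls 0 Zero;
  m_one := in_cls 0 One;
  m_plus := in_cls 0 Plus;
  m_times := in_cls 0 Times;
  m_K := fun r s => in_cls 0 (Kc r s);
  m_S := fun r s t => in_cls 0 (Sc r s t);
  m_R := in_cls 0 R0;
  m_lt := cls_lt;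
  ap_ext := cls_app_ext
|}.

(** * Truth in the term model *)

Lemma eval_term_model G s (u : tm G s) n (f : sub G (ctx_at n)) :
  eval (M := term_model) (fun s x => in_cls n (f s x)) u = in_cls n (sub_tm f u).
Proof.
  (* The constants were interpreted at stage [0]; lifting fixes them, so they have the same class at
     every stage. *)
  assert (h0 : forall s (c : forall G, tm G s), (forall m (p : later 0 m), ren_tm (lift p) (c _) = c _) ->
    in_cls 0 (c _) = in_cls n (c _)).
  { intros t c hc; pose (p := later_add n 0); rewrite <- (in_cls_lift p), hc; clear.
    now rewrite Nat.add_0_r. }
  induction u; simpl.
  - reflexivity.
  - rewrite IHu1, IHu2; apply cls_app_in.
  - now apply (h0 _ (fun G => Zero)).
  - now apply (h0 _ (fun G => One)).
  - now apply (h0 _ (fun G => Plus)).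
  - now apply (h0 _ (fun G => Times)).
  - now apply (h0 _ (fun G => Kc r s)).
  - now apply (h0 _ (fun G => Sc r s t)).
  - now apply (h0 _ (fun G => R0)).
Qed.

(** Truth lemma. [Imp] and [Or] rest on completeness of the theory, [All] and [Ex] on the Henkin
    witnesses. *)
Lemma sat_term_model G (A : fm G) : forall n (f : sub G (ctx_at n)),
  sat A (fun s x => in_cls n (f s x) : term_model s) <-> Th n (sub_fm A f).
Proof.
  (* An element coming from another stage and the old environment are both moved to a common stage
     [N]. *)
  assert (hs : forall G t n (f : sub G (ctx_at n)) m (u : tm (ctx_at m) t) N (p : later n N) (q : later m N),
    scons_var cls_dom (in_cls m u) (fun s x => in_cls n (f s x)) =
    (fun s x => in_cls N (scons_var (tm (ctx_at N)) (ren_tm (lift q) u)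
       (fun s x => ren_tm (lift p) (f s x)) x))).
  { intros; apply (var_fun_ext cls_dom); intros; simpl; now rewrite in_cls_lift. }
  assert (hi : forall G t (B : fm (t :: G)) n (f : sub G (ctx_at n)) N (p : later n N) u,
    inst (ren_fm (sub_fm B (up f)) (up_ren (lift p))) u =
    sub_fm B (scons_var (tm (ctx_at N)) u (fun s x => ren_tm (lift p) (f s x)))).
  { intros; unfold inst; rewrite ren_sub_fm, sub_sub_fm; f_equal.
    apply (var_fun_ext (tm _)); [reflexivity|]; intros; simpl; unfold wk.
    rewrite ren_ren_tm, sub_ren_tm, ren_tm_sub; reflexivity. }
  induction A as [G u v|G u v| |G A hA B hB|G A hA B hB|G A hA B hB|G t A hA|G t A hA];
    intros n f; simpl.
  - rewrite !eval_term_model; exact (in_cls_eq (s := N) n _ _).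
  - rewrite !eval_term_model; apply cls_lt_in.
  - split; [easy | apply Th_Bot].
  - rewrite hA, hB; split.
    + intro h; destruct (Th_complete n (sub_fm A f)) as [h'|h'].
      * generalize (h h'); apply Th_prv1; intro k; apply ImpI.
        eapply prv_weaken; [exact k | now apply incl_tl].
      * revert h'; apply Th_prv1; intro k; apply ImpI, RAA.
        eapply ImpE; [|apply Hyp; right; now left].
        eapply prv_weaken; [exact k | now do 2 apply incl_tl].
    + intros h h'; generalize h h'; apply Th_prv2; intros k1 k2; exact (ImpE k1 k2).
  - rewrite hA, hB; split.
    + intros [h1 h2]; generalize h1 h2; apply Th_prv2; now apply AndI.
    + intro h; split; revert h; apply Th_prv1; [apply AndE1 | apply AndE2].
  - rewrite hA, hB; split.
    + intros [h|h]; revert h; apply Th_prv1; [apply OrI1 | apply OrI2].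
    + intro h; destruct (Th_complete n (sub_fm A f)) as [h'|h']; [now left | right].
      generalize h h'; apply Th_prv2; intros k1 k2; eapply OrE; [exact k1 | | apply Hyp; now left].
      apply RAA; eapply ImpE; [|apply Hyp; right; now left].
      eapply prv_weaken; [exact k2 | now do 2 apply incl_tl].
  - split.
    + intro h; apply Th_All; intros m p u; rewrite hi, <- hA.
      specialize (h (in_cls m u)); now rewrite (hs _ _ _ f _ u _ p later_refl) in h;
        simpl in h; rewrite ren_id_tm in h.
    + intros h c; destruct (cls_dom_rep c) as [m [u ->]].
      destruct (later_directed n m) as [N [p [q _]]]; rewrite (hs _ _ _ f _ u _ p q), hA, <- hi.
      now apply Th_AllE.
  - split.
    + intros [c h]; destruct (cls_dom_rep c) as [m [u ->]].
      destruct (later_directed n m) as [N [p [q _]]]; rewrite (hs _ _ _ f _ u _ p q), hA, <- hi in h.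
      now apply Th_ExI in h.
    + intro h; destruct (Th_Ex h) as [m [p [u hu]]]; rewrite hi, <- hA in hu.
      exists (in_cls m u); rewrite (hs _ _ _ f _ u _ p later_refl); simpl; now rewrite ren_id_tm.
Qed.

Lemma holds_term_model (A : sentence) : holds term_model A <-> Th 0 A.
Proof.
  rewrite <- (sub_id_fm A) at 2; rewrite <- (sat_term_model A 0 (@Var [])).
  unfold holds; replace (env_nil term_model) with (fun s (x : var [] s) => in_cls 0 (Var x) : term_model s);
    [reflexivity|].
  apply functional_extensionality_dep; intro s; apply functional_extensionality_dep; intro x.
  destruct (var_nil x).
Qed.

End Henkin.

(** Otherwise the term model grown from the negation of [A] satisfies [T], hence [A], and its theory
    is inconsistent. *)
Theorem completeness (T : theory) (hT : forall A, RCA0w A -> T A) (A : sentence) :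
  (forall M : model, (forall B, T B -> holds M B) -> holds M A) -> proves T A.
Proof.
  intro h; apply NNPP; intro hA.
  assert (hM : holds (term_model hT hA) A).
  { apply h; intros B hB; apply holds_term_model.
    exists 0, later_refl; simpl; rewrite ren_id_fm, <- embed_nil; now apply Ax. }
  apply holds_term_model in hM; apply (Th_Bot hA (n := 0)).
  assert (hN : Th T A 0 (Imp A Bot))
    by (exists 0, later_refl; simpl; rewrite !ren_id_fm; apply Hyp; now left).
  generalize hN hM; apply Th_prv2; intros k1 k2; exact (ImpE k1 k2).
Qed.

(** * Arithmetic in models *)

Lemma eval_ren (M : model) G D s (f : ren G D) (r : env M D) (u : tm G s) :
  eval r (ren_tm f u) = eval (fun s x => r s (f s x)) u.
Proof. induction u; simpl; congruence. Qed.

Lemma sat_eq_at (M : model) s : forall G (u v : tm G s) (r : env M G),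
  sat (eq_at u v) r <-> eval r u = eval r v.
Proof.
  induction s as [|s _ t IH]; intros G u v r; simpl; [reflexivity|].
  assert (e : forall a, sat (eq_at (wk u @ v0) (wk v @ v0)) (scons_var M a r) <->
    ap (eval r u) a = ap (eval r v) a).
  { intro a; rewrite IH; simpl; unfold wk; now rewrite !eval_ren. }
  split.
  - intro h; apply ap_ext; intro a; apply e, h.
  - intros h a; apply e; now rewrite h.
Qed.

Local Notation "f · x" := (ap f x) (at level 36, left associativity).

Definition m_add (M : model) (x y : M N) : M N := m_plus · x · y.
Definition m_mul (M : model) (x y : M N) : M N := m_times · x · y.
Arguments m_add {M} x y.
Arguments m_mul {M} x y.
Local Notation "x ⊕ y" := (m_add x y) (at level 50, left associativity).
Local Notation "x ⊗ y" := (m_mul x y) (at level 40, left associativity).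
Definition m_pair (M : model) (x y : M N) : M N := (x ⊕ y) ⊗ (x ⊕ y) ⊕ x.
Arguments m_pair {M} x y.

(** Bracket abstraction: [abs M s (fun x => E)] is a combinator term denoting [E] as a
    function of [x : M s]. *)
Ltac abs M s E :=
  lazymatch E with
  | fun _ => ?c => lazymatch type of c with dom _ ?t => constr:(ap (@m_K M t s) c) end
  | fun x => x => constr:(ap (ap (@m_S M s (s ~> s) s) (@m_K M s (s ~> s))) (@m_K M s s))
  | fun x => @ap _ ?a ?b (@?g x) (@?h x) =>
      let g' := abs M s g in let h' := abs M s h in constr:(ap (ap (@m_S M s a b) g') h')
  end.

Ltac abs2 M s t E :=
  let F := constr:(fun inner_arg : dom M s =>
    ltac:(let b := eval cbv beta in (E inner_arg) in let r := abs M t b in exact r)) in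
  let F := eval cbv beta in F in abs M s F.

Ltac abs3 M s t u E :=
  let F := constr:(fun outer_arg : dom M s =>
    ltac:(let b := eval cbv beta in (E outer_arg) in let r := abs2 M t u b in exact r)) in
  let F := eval cbv beta in F in abs M s F.

Section Arithmetic.
Context (M : model) (hM : forall A, RCA0w A -> holds M A).

Implicit Types x y z n d e p : M N.
Notation zero := (@m_zero M).
Notation one := (@m_one M).
Notation lt := (m_lt M).

Lemma KE r s (x : M r) (y : M s) : m_K r s · x · y = x.
Proof.
  pose proof (hM (rca_K r s)) as h; unfold holds in h; simpl in h.
  specialize (h x y); now rewrite sat_eq_at in h.
Qed.

Lemma SE r s t (x : M (r ~> s ~> t)) (y : M (r ~> s)) (z : M r) :
  m_S r s t · x · y · z = x · z · (y · z).
Proof.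
  pose proof (hM (rca_S r s t)) as h; unfold holds in h; simpl in h.
  specialize (h x y z); now rewrite sat_eq_at in h.
Qed.

(** Proves that an explicitly defined functional exists: the right side of the goal is abstracted to
    a combinator term, then checked by the equations for [K] and [S]. *)
Ltac lam :=
  intros; unfold m_pair, m_add, m_mul;
  lazymatch goal with
  | |- exists f, forall (x : dom _ ?s) (y : dom _ ?t) (z : dom _ ?u), f · x · y · z = @?E x y z =>
      let c := abs3 M s t u E in exists c
  | |- exists f, forall (x : dom _ ?s) (y : dom _ ?t), f · x · y = @?E x y =>
      let c := abs2 M s t E in exists c
  | |- exists f, forall (x : dom _ ?s), f · x = @?E x => let c := abs M s E in exists c
  end; intros; repeat (rewrite KE || rewrite SE); reflexivity.

Lemma R_zero f x : m_R · f · x · zero = x.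
Proof. exact (hM rca_R0_0 f x). Qed.

Lemma R_succ f x n : m_R · f · x · (n ⊕ one) = f · (m_R · f · x · n).
Proof. exact (hM rca_R0_succ f x n). Qed.

Lemma add_assoc x y z : (x ⊕ y) ⊕ z = x ⊕ (y ⊕ z).
Proof. exact (hM (rca_basic add_assoc) x y z). Qed.
Lemma add_comm x y : x ⊕ y = y ⊕ x.
Proof. exact (hM (rca_basic add_comm) x y). Qed.
Lemma add_0_r x : x ⊕ zero = x.
Proof. exact (hM (rca_basic add_0) x). Qed.
Lemma mul_assoc x y z : (x ⊗ y) ⊗ z = x ⊗ (y ⊗ z).
Proof. exact (hM (rca_basic mul_assoc) x y z). Qed.
Lemma mul_comm x y : x ⊗ y = y ⊗ x.
Proof. exact (hM (rca_basic mul_comm) x y). Qed.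
Lemma mul_0_r x : x ⊗ zero = zero.
Proof. exact (hM (rca_basic mul_0) x). Qed.
Lemma mul_1_r x : x ⊗ one = x.
Proof. exact (hM (rca_basic mul_1) x). Qed.
Lemma mul_add_r x y z : x ⊗ (y ⊕ z) = x ⊗ y ⊕ x ⊗ z.
Proof. exact (hM (rca_basic mul_add) x y z). Qed.

Lemma model_semi_ring : semi_ring_theory zero one (@m_add M) (@m_mul M) eq.
Proof.
  split; intros.
  - rewrite add_comm; apply add_0_r.
  - apply add_comm.
  - symmetry; apply add_assoc.
  - rewrite mul_comm; apply mul_1_r.
  - rewrite mul_comm; apply mul_0_r.
  - apply mul_comm.
  - symmetry; apply mul_assoc.
  - rewrite !(mul_comm _ p); apply mul_add_r.
Qed.
Add Ring model_ring : model_semi_ring.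

Lemma lt_irrefl x : ~ lt x x.
Proof. exact (hM (rca_basic lt_irrefl) x). Qed.
Lemma lt_trans x y z : lt x y -> lt y z -> lt x z.
Proof. exact (hM (rca_basic lt_trans) x y z). Qed.
Lemma lt_total x y : lt x y \/ x = y \/ lt y x.
Proof. exact (hM (rca_basic lt_total) x y). Qed.
Lemma lt_add x y z : lt x y -> lt (x ⊕ z) (y ⊕ z).
Proof. exact (hM (rca_basic lt_add) x y z). Qed.
Lemma lt_mul x y z : lt x y -> lt zero z -> lt (x ⊗ z) (y ⊗ z).
Proof. exact (hM (rca_basic lt_mul) x y z). Qed.
Lemma lt_0_1 : lt zero one.
Proof. exact (hM (rca_basic lt_0_1)). Qed.
Lemma not_lt_0 x : ~ lt x zero.
Proof. exact (hM (rca_basic nonneg) x). Qed.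
Lemma lt_succ x y : lt x (y ⊕ one) <-> lt x y \/ x = y.
Proof. exact (hM (rca_basic discrete) x y). Qed.

Lemma not_lt_succ x y : ~ lt y (x ⊕ one) <-> lt x y.
Proof.
  rewrite lt_succ; split.
  - intro h; destruct (lt_total x y) as [k|[k|k]]; auto; destruct h; auto.
  - intros k [k'| ->]; [exact (lt_irrefl _ (lt_trans _ _ _ k k')) | exact (lt_irrefl _ k)].
Qed.

Lemma zero_or_pos x : x = zero \/ lt zero x.
Proof. destruct (lt_total x zero) as [h|[h|h]]; auto; now apply not_lt_0 in h. Qed.

Lemma pos_iff x : lt zero x <-> x <> zero.
Proof.
  split; [intros h ->; now apply lt_irrefl in h | now destruct (zero_or_pos x)].
Qed.

(** If both alternatives fail, quantifier-free induction yields [x ⊕ n < y] for all [n], which is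
    absurd for [n = y]. *)
Lemma sub_exists x y : (exists d, x ⊕ d = y) \/ lt y x.
Proof.
  apply NNPP; intro h.
  assert (hn : forall n, lt (x ⊕ n) y).
  { apply (hM (@rca_ind [N; N] (v1 [+] v0 [<] v2) I) y x).
    - change (lt (x ⊕ zero) y); rewrite add_0_r.
      destruct (lt_total x y) as [h'|[h'|h']]; [easy | | now destruct h; right].
      destruct h; left; exists zero; now rewrite add_0_r.
    - intros n hn; change (lt (x ⊕ (n ⊕ one)) y); change (lt (x ⊕ n) y) in hn.
      rewrite <- add_assoc; destruct (lt_total (x ⊕ n ⊕ one) y) as [h'|[h'|h']]; [easy| |].
      + destruct h; left; exists (n ⊕ one); now rewrite <- add_assoc.
      + apply lt_succ in h' as [h'|h']; [|rewrite <- h' in hn];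
          [exfalso; apply (lt_irrefl _ (lt_trans _ _ _ hn h')) | now apply lt_irrefl in hn]. }
  specialize (hn y); destruct (zero_or_pos x) as [->|hx].
  - replace (zero ⊕ y) with y in hn by ring; now apply lt_irrefl in hn.
  - apply (fun h => lt_add _ _ y h) in hx; replace (zero ⊕ y) with y in hx by ring.
    exact (lt_irrefl _ (lt_trans _ _ _ hn hx)).
Qed.

(** Turns inequalities into equations, which [ring] can handle. *)
Lemma lt_iff x y : lt x y <-> exists d, y = x ⊕ one ⊕ d.
Proof.
  split.
  - intro h; destruct (sub_exists (x ⊕ one) y) as [[d e]|h']; [now exists d|].
    apply lt_succ in h' as [h'| ->]; exfalso; [exact (lt_irrefl _ (lt_trans _ _ _ h h')) | exact (lt_irrefl _ h)].
  - intros [d ->]; assert (h : lt x (x ⊕ one)) by (apply lt_succ; now right).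
    destruct (zero_or_pos d) as [->|hd]; [now rewrite add_0_r|].
    apply (fun h => lt_add _ _ (x ⊕ one) h) in hd; replace (zero ⊕ (x ⊕ one)) with (x ⊕ one) in hd by ring.
    replace (d ⊕ (x ⊕ one)) with (x ⊕ one ⊕ d) in hd by ring; exact (lt_trans _ _ _ h hd).
Qed.

Lemma le_or_gt x y : (exists d, y = x ⊕ d) \/ (exists d, x = y ⊕ one ⊕ d).
Proof.
  destruct (sub_exists x y) as [[d h]|h]; [left; now exists d | right; now apply lt_iff].
Qed.

Lemma add_succ_neq x d : x ⊕ one ⊕ d <> x.
Proof. intro e; apply (lt_irrefl x), lt_iff; now exists d. Qed.

Lemma add_cancel_l x y z : x ⊕ y = x ⊕ z -> y = z.
Proof.
  rewrite !(add_comm x); intro h; destruct (lt_total y z) as [h'|[h'|h']]; [|easy|];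
    apply (fun h => lt_add _ _ x h) in h'; rewrite h in h'; now apply lt_irrefl in h'.
Qed.

Lemma zero_or_succ x : x = zero \/ exists y, x = y ⊕ one.
Proof.
  destruct (zero_or_pos x) as [h|h]; [now left | right].
  apply lt_iff in h as [d ->]; exists d; ring.
Qed.

Lemma succ_neq_0 x : x ⊕ one <> zero.
Proof.
  intro h; apply (not_lt_0 x); rewrite <- h; apply lt_succ; now right.
Qed.

Lemma add_eq_0 x y : x ⊕ y = zero <-> x = zero /\ y = zero.
Proof.
  split; [|intros [-> ->]; ring].
  intro h; destruct (zero_or_succ x) as [->|[d ->]].
  - split; [easy | rewrite <- h; ring].
  - destruct (succ_neq_0 (d ⊕ y)); rewrite <- h; ring.
Qed.

Lemma mul_eq_0 x y : x ⊗ y = zero <-> x = zero \/ y = zero.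
Proof.
  split; [|intros [-> | ->]; ring].
  intro h; destruct (zero_or_pos x) as [|hx]; [now left|].
  destruct (zero_or_pos y) as [|hy]; [now right|].
  pose proof (lt_mul _ _ _ hx hy) as k; rewrite h in k; now apply not_lt_0 in k.
Qed.

Lemma one_neq_0 : one <> zero.
Proof. intro h; pose proof lt_0_1 as k; rewrite h in k; now apply lt_irrefl in k. Qed.

Lemma ind_eq (u v : M ty1) : u · zero = v · zero ->
  (forall n, u · n = v · n -> u · (n ⊕ one) = v · (n ⊕ one)) -> forall n, u · n = v · n.
Proof. exact (hM (@rca_ind [ty1; ty1] (v2 @ v0 [=] v1 @ v0) I) u v). Qed.

Lemma choice_ty1 (c : M (ty1 ~> N ~> N)) : (forall f, exists n, c · f · n = zero) ->
  exists Y : M ty2, forall f, c · f · (Y · f) = zero.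
Proof.
  exact (hM (rca_ac (@qf_ac ty1 N [ty1 ~> N ~> N] (v2 @ v1 @ v0 [=] Zero) I)) c).
Qed.

(** * Truncated subtraction and the Boolean operations it provides *)

Lemma monus_exists : exists m : M (N ~> N ~> N),
  (forall x d, m · (x ⊕ d) · x = d) /\ (forall x d, m · x · (x ⊕ one ⊕ d) = zero).
Proof.
  (* Choice takes an argument of type [1], so the two numbers are passed as [f 0] and [f 1]. *)
  destruct (hM (rca_ac (@qf_ac ty1 N []
    (v1 @ One [+] v0 [=] v1 @ Zero [\/] (v1 @ Zero [<] v1 @ One [/\] v0 [=] Zero)) (conj I (conj I I)))))
    as [Y hY].
  { intro f; destruct (sub_exists (f · one) (f · zero)) as [[d h]|h].
    - exists d; now left.
    - exists zero; now right. }
  (* Iterating the constant map with value [y] from [x] gives a function sending [0] to [x] and [1]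
     to [y]. *)
  assert (hm : exists m : M (N ~> N ~> N), forall x y, m · x · y = Y · (m_R · (m_K N N · y) · x)) by lam.
  destruct hm as [m hm]; exists m.
  assert (h1 : forall x y, m_R · (m_K N N · y) · x · one = y).
  { intros x y; replace one with (zero ⊕ one) by ring; now rewrite R_succ, KE. }
  split; intros x d; rewrite hm.
  - destruct (hY (m_R · (m_K N N · x) · (x ⊕ d))) as [h|[h _]]; simpl in h; rewrite h1, R_zero in h.
    + now apply add_cancel_l in h.
    + apply lt_iff in h as [e h]; exfalso; symmetry in h.
      replace (x ⊕ d ⊕ one ⊕ e) with (x ⊕ one ⊕ (d ⊕ e)) in h by ring; exact (add_succ_neq _ h).
  - destruct (hY (m_R · (m_K N N · (x ⊕ one ⊕ d)) · x)) as [h|[_ h]]; simpl in h.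
    + rewrite h1, R_zero in h; exfalso; eapply add_succ_neq; rewrite <- add_assoc; exact h.
    + exact h.
Qed.

Definition monus : M (N ~> N ~> N) := proj1_sig (constructive_indefinite_description _ monus_exists).
Notation "x ∸ y" := (monus · x · y) (at level 50, left associativity).

Lemma monus_add x d : x ⊕ d ∸ x = d.
Proof. apply (proj2_sig (constructive_indefinite_description _ monus_exists)). Qed.

Lemma monus_lt x d : x ∸ (x ⊕ one ⊕ d) = zero.
Proof. apply (proj2_sig (constructive_indefinite_description _ monus_exists)). Qed.

Lemma monus_eq_0 x y : x ∸ y = zero <-> ~ lt y x.
Proof.
  split.
  - intros h k; apply lt_iff in k as [d ->].
    replace (y ⊕ one ⊕ d) with (y ⊕ (d ⊕ one)) in h by ring; rewrite monus_add in h.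
    now apply succ_neq_0 in h.
  - intro h; destruct (le_or_gt x y) as [[d ->]|k]; [|now apply lt_iff in k].
    destruct (zero_or_succ d) as [->|[e ->]].
    + rewrite <- (add_0_r x) at 1; replace (x ⊕ zero) with x by ring.
      rewrite <- (add_0_r x) at 1; apply monus_add.
    + replace (x ⊕ (e ⊕ one)) with (x ⊕ one ⊕ e) by ring; apply monus_lt.
Qed.

Lemma neg_0 : one ∸ zero = one.
Proof. replace one with (zero ⊕ one) at 1 by ring; apply monus_add. Qed.

Lemma neg_eq_0 x : one ∸ x = zero <-> x <> zero.
Proof.
  rewrite monus_eq_0; replace one with (zero ⊕ one) by ring; rewrite lt_succ; split.
  - intros h ->; apply h; now right.
  - intros h [k|k]; [now apply not_lt_0 in k | easy].
Qed.

Lemma neg_bool x : one ∸ x = zero \/ one ∸ x = one.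
Proof.
  destruct (zero_or_succ x) as [->|[y ->]]; [right; apply neg_0 | left].
  apply neg_eq_0, succ_neq_0.
Qed.

Lemma dist_eq_0 x y : (x ∸ y) ⊕ (y ∸ x) = zero <-> x = y.
Proof.
  rewrite add_eq_0, !monus_eq_0; split; [|intros ->; split; apply lt_irrefl].
  intros [h k]; now destruct (lt_total x y) as [|[|]].
Qed.
Notation dist x y := ((x ∸ y) ⊕ (y ∸ x)).

(** * Coding and recursion *)

Definition definable (a : M N -> M N) : Prop := exists u : M ty1, forall n, u · n = a n.
(** There is a characteristic function inside the model, with [zero] for truth; this is the form in
    which quantifier-free induction is applied. *)
Definition decidable (P : M N -> Prop) : Prop := exists u : M ty1, forall n, u · n = zero <-> P n.

Lemma induction (P : M N -> Prop) : decidable P ->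
  P zero -> (forall n, P n -> P (n ⊕ one)) -> forall n, P n.
Proof.
  intros [u hu] h0 hS n; apply hu; rewrite <- (KE N N zero n); revert n; apply ind_eq.
  - rewrite KE; now apply hu.
  - intros n h; rewrite KE in *; now apply hu, hS, hu.
Qed.

Lemma decidable_eq a b : definable a -> definable b -> decidable (fun n => a n = b n).
Proof.
  intros [u hu] [v hv].
  assert (h : exists w : M ty1, forall n, w · n = dist (u · n) (v · n)) by lam.
  destruct h as [w h]; exists w; intro n; now rewrite h, dist_eq_0, hu, hv.
Qed.

Lemma decidable_not P : decidable P -> decidable (fun n => ~ P n).
Proof.
  intros [u hu].
  assert (h : exists w : M ty1, forall n, w · n = one ∸ (u · n)) by lam.
  destruct h as [w h]; exists w; intro n; now rewrite h, neg_eq_0, hu.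
Qed.

Lemma decidable_or P Q : decidable P -> decidable Q -> decidable (fun n => P n \/ Q n).
Proof.
  intros [u hu] [v hv].
  assert (h : exists w : M ty1, forall n, w · n = (u · n) ⊗ (v · n)) by lam.
  destruct h as [w h]; exists w; intro n; now rewrite h, mul_eq_0, hu, hv.
Qed.

(** * Integer square roots and unpairing *)

Lemma sqrt_exists z : exists w, ~ lt z (w ⊗ w) /\ lt z ((w ⊕ one) ⊗ (w ⊕ one)).
Proof.
  apply NNPP; intro h.
  assert (hw : forall w, w ⊗ w ∸ z = zero).
  { apply induction.
    - apply decidable_eq; red; lam.
    - apply monus_eq_0; replace (zero ⊗ zero) with zero by ring; apply not_lt_0.
    - intros w hw; apply monus_eq_0 in hw; apply monus_eq_0; intro k; apply h; now exists w. }
  (* Without a root, all squares would be at most [z]; the square of [z ⊕ one] is not. *)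
  specialize (hw (z ⊕ one)); apply monus_eq_0 in hw; apply hw, lt_iff.
  exists (z ⊗ z ⊕ z); ring.
Qed.

Lemma sqrt_fun_exists : exists s : M ty1, forall z,
  ~ lt z ((s · z) ⊗ (s · z)) /\ lt z ((s · z ⊕ one) ⊗ (s · z ⊕ one)).
Proof.
  assert (hc : exists c : M (ty1 ~> N ~> N), forall f n, c · f · n =
    (n ⊗ n ∸ (f · zero)) ⊕ ((f · zero ⊕ one) ∸ ((n ⊕ one) ⊗ (n ⊕ one)))) by lam.
  destruct hc as [c hc].
  assert (e : forall z w, (w ⊗ w ∸ z) ⊕ ((z ⊕ one) ∸ ((w ⊕ one) ⊗ (w ⊕ one))) = zero <->
    ~ lt z (w ⊗ w) /\ lt z ((w ⊕ one) ⊗ (w ⊕ one))).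
  { intros z w; now rewrite add_eq_0, !monus_eq_0, not_lt_succ. }
  destruct (choice_ty1 c) as [Y hY].
  { intro f; destruct (sqrt_exists (f · zero)) as [w hw]; exists w; rewrite hc; now apply e. }
  assert (hs : exists s : M ty1, forall z, s · z = Y · (m_K N N · z)) by lam.
  destruct hs as [s hs]; exists s; intro z; apply e; rewrite hs.
  specialize (hY (m_K N N · z)); rewrite hc, !KE in hY; exact hY.
Qed.

Lemma square_mono x y : lt x y -> ~ lt (y ⊗ y) ((x ⊕ one) ⊗ (x ⊕ one)).
Proof.
  intros h k; apply lt_iff in h as [d ->], k as [e k].
  symmetry in k; apply (@add_succ_neq ((x ⊕ one) ⊗ (x ⊕ one)) (e ⊕ d ⊗ d ⊕ (x ⊕ one) ⊗ d ⊕ (x ⊕ one) ⊗ d)).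
  rewrite <- k at 2; ring.
Qed.

(** The code [(x + y)^2 + x] lies below [(x + y + 1)^2], so its integer root is [x + y] and the
    remainder is [x]. *)
Lemma unpair_exists : exists l r : M ty1, forall x y,
  l · m_pair x y = x /\ r · m_pair x y = y.
Proof.
  destruct sqrt_fun_exists as [s hs].
  assert (hl : exists l : M ty1, forall z, l · z = z ∸ ((s · z) ⊗ (s · z))) by lam.
  destruct hl as [l hl].
  assert (hr : exists r : M ty1, forall z, r · z = (s · z) ∸ (l · z)) by lam.
  destruct hr as [r hr]; exists l, r; intros x y.
  assert (e : s · m_pair x y = x ⊕ y).
  { destruct (hs (m_pair x y)) as [h1 h2]; set (w := s · m_pair x y) in *.
    destruct (lt_total w (x ⊕ y)) as [k|[k|k]]; [exfalso|easy|exfalso].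
    - apply square_mono in k; apply lt_iff in h2 as [d h2]; apply k, lt_iff.
      exists (x ⊕ d); rewrite h2; unfold m_pair; ring.
    - apply square_mono in k; apply k; clear k.
      destruct (le_or_gt (w ⊗ w) (m_pair x y)) as [[d h]|h]; [|now apply lt_iff in h].
      apply lt_iff; exists (d ⊕ y ⊕ x ⊕ y).
      transitivity (m_pair x y ⊕ one ⊕ (y ⊕ x ⊕ y)); [unfold m_pair; ring | rewrite h; ring]. }
  assert (hx : l · m_pair x y = x) by (rewrite hl, e; apply monus_add).
  split; [exact hx|]; rewrite hr, hx, e; apply monus_add.
Qed.

Lemma decidable_lt a b : definable a -> definable b -> decidable (fun n => lt (a n) (b n)).
Proof.
  intros [u hu] [v hv].
  assert (h : exists w : M ty1, forall n, w · n = (u · n ⊕ one) ∸ (v · n)) by lam.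
  destruct h as [w h]; exists w; intro n.
  rewrite h, monus_eq_0, hu, hv; apply not_lt_succ.
Qed.

(** [R0] iterates a map that does not see the index, so the state is the pair of index and value;
    induction shows that the first component counts the steps. *)
Lemma recursor_exists : exists rec : M ((N ~> N ~> N) ~> N ~> N ~> N), forall F a,
  rec · F · a · zero = a /\ forall n, rec · F · a · (n ⊕ one) = F · n · (rec · F · a · n).
Proof.
  destruct unpair_exists as [l [r hlr]].
  assert (hs : exists s : M ((N ~> N ~> N) ~> N ~> N), forall F z,
    s · F · z = m_pair (l · z ⊕ one) (F · (l · z) · (r · z))) by lam.
  destruct hs as [s hs].
  assert (hg : exists g : M ((N ~> N ~> N) ~> N ~> N ~> N), forall F a n,
    g · F · a · n = r · (m_R · (s · F) · m_pair zero a · n)) by lam.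
  destruct hg as [g hg]; exists g; intros F a.
  assert (hl : forall n, l · (m_R · (s · F) · m_pair zero a · n) = n).
  { apply induction.
    - apply decidable_eq; red; lam.
    - rewrite R_zero; apply hlr.
    - intros n h; rewrite R_succ, hs, h; apply hlr. }
  split; [|intro n]; rewrite !hg.
  - rewrite R_zero; apply hlr.
  - rewrite R_succ, hs, hl; apply hlr.
Qed.

(** [b · h · n] is the product of the values [h · i] for [i < n]. *)
Lemma bounded_search_exists : exists b : M (ty1 ~> N ~> N), forall h n,
  b · h · n = zero <-> exists i, lt i n /\ h · i = zero.
Proof.
  destruct recursor_exists as [rec hrec].
  assert (hF : exists F : M (ty1 ~> N ~> N ~> N), forall h n v, F · h · n · v = (h · n) ⊗ v) by lam.
  destruct hF as [F hF].
  assert (hb : exists b : M (ty1 ~> N ~> N), forall h n, b · h · n = rec · (F · h) · one · n) by lam.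
  destruct hb as [b hb]; exists b; intros h n.
  assert (b0 : b · h · zero = one) by (rewrite hb; apply hrec).
  assert (bS : forall n, b · h · (n ⊕ one) = (h · n) ⊗ (b · h · n)).
  { intro m; rewrite !hb, <- hF; apply hrec. }
  split.
  - intro hn; apply NNPP; intro hno.
    (* Without a zero of [h] below [n], the partial products up to [n] stay nonzero; the first
       disjunct confines the induction to [k <= n]. *)
    assert (hk : forall k, lt n k \/ b · h · k <> zero).
    { apply induction.
      - apply decidable_or; [|apply decidable_not]; [apply decidable_lt | apply decidable_eq]; red; lam.
      - right; rewrite b0; apply one_neq_0.
      - intros m [hm|hm]; [left; apply lt_succ; now left|].
        destruct (classic (lt m n)) as [k|k].
        + right; rewrite bS, mul_eq_0; intros [e|e]; [|easy]; apply hno; now exists m.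
        + left; apply lt_succ; destruct (lt_total n m) as [|[|]]; auto; now destruct k. }
    destruct (hk n) as [e|e]; [now apply lt_irrefl in e | easy].
  - intros [i [hi hz]]; apply lt_iff in hi as [d ->]; revert d; apply induction.
    + apply decidable_eq; red; lam.
    + rewrite add_0_r, bS, hz; ring.
    + intros d hd; rewrite <- add_assoc, bS, hd; ring.
Qed.

Lemma lt_one x : lt x one <-> x = zero.
Proof.
  replace one with (zero ⊕ one) by ring; rewrite lt_succ; split; [|now right].
  intros [h|h]; [now apply not_lt_0 in h | easy].
Qed.

(** * Splitting [kappa_0] *)

Definition binary (f : M ty1) : Prop := forall n, f · n = zero \/ f · n = one.

Lemma sat_inC G (f : tm G ty1) (r : env M G) : sat (inC f) r <-> binary (eval r f).
Proof.
  unfold binary; simpl; split; intros h n; specialize (h n); unfold wk in *;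
    rewrite eval_ren, KE, lt_one in *; exact h.
Qed.

Definition is_kappa0 (k : M ty3) : Prop :=
  forall Y, k · Y = zero <-> exists f, binary f /\ Y · f <> zero.

Lemma holds_kappa0 : holds M kappa0 -> exists k, is_kappa0 k.
Proof.
  intros [k hk]; exists k; intro Y; split.
  - intro h; apply (proj1 (hk Y)) in h as [f [h1 h2]]; exists f; split;
      [now apply sat_inC in h1 | now apply pos_iff in h2].
  - intros [f [h1 h2]]; apply (proj2 (hk Y)); exists f; split; [now apply sat_inC | now apply pos_iff].
Qed.

Definition is_exists2 (E : M ty2) : Prop := forall f, E · f = zero <-> exists n, f · n = zero.

Lemma holds_exists3 (e : M ty3) : (forall Y, e · Y = zero \/ e · Y = one) ->
  (forall Y, (exists f, Y · f = zero) <-> e · Y = zero) -> holds M exists3.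
Proof.
  intros h1 h2; exists e; split.
  - intro Y; simpl; rewrite KE, lt_one; apply h1.
  - intro Y; exact (h2 Y).
Qed.

Lemma pair_inj x y x' y' : m_pair x y = m_pair x' y' -> x = x' /\ y = y'.
Proof.
  intro h; destruct unpair_exists as [l [r hlr]].
  destruct (hlr x y) as [h1 h2], (hlr x' y') as [h3 h4]; rewrite h in *.
  split; congruence.
Qed.

Lemma add_cancel_r x y z : y ⊕ x = z ⊕ x -> y = z.
Proof. rewrite !(add_comm _ x); apply add_cancel_l. Qed.

(** If [f] and [g] differ at [i], the codes differ at [i + 1], and injectivity of pairing keeps them
    different up to [n], where they should agree. *)
Lemma sat_initseg_eq G (f g : tm G ty1) (n : tm G N) (r : env M G) : sat (initseg_eq f n g n) r ->
  forall i, lt i (eval r n) -> eval r f · i = eval r g · i.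
Proof.
  intros [s [[h [h0 [hS hs]]] [h' [h'0 [h'S h's]]]]] i hi.
  simpl in *; unfold wk in *; rewrite !eval_ren in *; simpl in *.
  change (h · eval r n = s) in hs; change (h' · eval r n = s) in h's.
  assert (hS' : forall j, lt j (eval r n) -> h · (j ⊕ one) = m_pair (h · j) (eval r f · j) ⊕ one).
  { intros j hj; specialize (hS j); rewrite !eval_ren in hS; exact (hS hj). }
  assert (h'S' : forall j, lt j (eval r n) -> h' · (j ⊕ one) = m_pair (h' · j) (eval r g · j) ⊕ one).
  { intros j hj; specialize (h'S j); rewrite !eval_ren in h'S; exact (h'S hj). }
  apply NNPP; intro hne.
  apply lt_iff in hi as [e he]; rewrite he in *.
  (* The length is [i ⊕ one ⊕ e], so the claim is made only for [d <= e]. *)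
  assert (hd : forall d, lt e d \/ h · (i ⊕ one ⊕ d) <> h' · (i ⊕ one ⊕ d)).
  { apply induction.
    - apply decidable_or; [|apply decidable_not]; [apply decidable_lt | apply decidable_eq]; red; lam.
    - right; rewrite add_0_r, hS', h'S' by (apply lt_iff; now exists e).
      intro k; now apply add_cancel_r, pair_inj in k as [_ k].
    - intros d [hd|hd]; [left; apply lt_succ; now left|].
      destruct (le_or_gt e d) as [[p ->]|[p hp]].
      + left; apply lt_succ; destruct (zero_or_pos p) as [->|hp]; [right; ring | left].
        apply lt_iff in hp as [p' ->]; apply lt_iff; exists p'; ring.
      + right; rewrite <- add_assoc, hS', h'S'.
        * intro k; now apply add_cancel_r, pair_inj in k as [k _].
        * apply lt_iff; exists p; rewrite hp; ring.
        * apply lt_iff; exists p; rewrite hp; ring. }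
  destruct (hd e) as [k|k]; [now apply lt_irrefl in k | apply k; congruence].
Qed.

Lemma holds_MUC (O : M ty3) : (forall Y f g, binary f -> binary g ->
  (forall i, lt i (O · Y) -> f · i = g · i) -> Y · f = Y · g) -> holds M MUC.
Proof.
  intro h; exists O; intros Y f g hf hg hfg.
  apply sat_inC in hf, hg; apply (h Y f g hf hg); intros i hi; exact (@sat_initseg_eq _ _ _ _ _ hfg _ hi).
Qed.

(** Given [exists^2], the operator [mu] decodes a point of Cantor space, read as the graph of
    a function, so that [kappa_0] quantifies over the whole of Baire space. *)
Lemma exists2_exists3 (k : M ty3) (E : M ty2) : is_kappa0 k -> is_exists2 E -> holds M exists3.
Proof.
  intros hk hE; destruct unpair_exists as [l [r hlr]].
  (* [c · f · n] vanishes iff [f · n = zero] or [f] has no zero, so some [n] always qualifies and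
     choice gives the search operator [mu]. *)
  assert (hc : exists c : M (ty1 ~> N ~> N), forall f n, c · f · n = (f · n) ⊗ (one ∸ (E · f))) by lam.
  destruct hc as [c hc].
  destruct (choice_ty1 c) as [mu hmu].
  { intro f; destruct (classic (E · f = zero)) as [h|h].
    - apply hE in h as [n h]; exists n; rewrite hc, h; ring.
    - exists zero; apply neg_eq_0 in h; rewrite hc, h; ring. }
  assert (hm : forall f n, f · n = zero -> f · (mu · f) = zero).
  { intros f n h; specialize (hmu f); rewrite hc in hmu; apply mul_eq_0 in hmu as [|h']; [easy|].
    apply neg_eq_0 in h'; destruct h'; apply hE; now exists n. }
  assert (hrow : exists row : M (ty1 ~> N ~> N ~> N), forall g n j, row · g · n · j = g · m_pair n j) by lam.
  destruct hrow as [row hrow].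
  assert (hdec : exists dec : M (ty1 ~> N ~> N), forall g n, dec · g · n = mu · (row · g · n)) by lam.
  destruct hdec as [dec hdec].
  assert (hz : exists z : M (ty2 ~> ty1 ~> N), forall Y g, z · Y · g = one ∸ (Y · (dec · g))) by lam.
  destruct hz as [z hz].
  (* The double negation cuts the value of [k] down to [zero] or [one], as the bound in [exists3]
     demands. *)
  assert (he : exists e : M ty3, forall Y, e · Y = one ∸ (one ∸ (k · (z · Y)))) by lam.
  destruct he as [e he].
  assert (hsurj : forall f, exists g, binary g /\ dec · g = f).
  { intro f.
    (* [g] vanishes exactly on the codes of pairs [(n, f · n)], so row [n] has the single zero
       [f · n], which [mu] must find. *)
    assert (hg : exists g : M ty1, forall n,
      g · n = one ∸ (one ∸ (dist (r · n) (f · (l · n))))) by lam.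
    destruct hg as [g hg]; exists g; split; [intro n; rewrite hg; apply neg_bool|].
    apply ap_ext; intro n; rewrite hdec.
    assert (h0 : forall j, g · m_pair n j = zero <-> j = f · n).
    { intro j; destruct (hlr n j) as [e1 e2]; rewrite hg, neg_eq_0, neg_eq_0, e1, e2, dist_eq_0.
      split; [apply NNPP | tauto]. }
    apply h0; rewrite <- hrow; apply hm with (f · n); rewrite hrow; now apply h0. }
  apply (@holds_exists3 e); intro Y; rewrite he; [apply neg_bool|].
  rewrite neg_eq_0, neg_eq_0; split.
  - intros [f hf] h; apply h, hk; destruct (hsurj f) as [g [hb <-]].
    exists g; split; [easy|]; now rewrite hz, hf, neg_0; apply one_neq_0.
  - intro h; apply NNPP, hk in h as [g [_ h]]; exists (dec · g).
    rewrite hz in h; apply NNPP; intro h'; apply h; now apply neg_eq_0.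
Qed.

(** If [G] is unbounded on Cantor space, then [h] has a zero iff it has one below [G f] for some
    [f] in Cantor space, which [kappa_0] decides. *)
Lemma bounded_on_C (k : M ty3) (G : M ty2) : is_kappa0 k -> (forall E, ~ is_exists2 E) ->
  exists n, forall f, binary f -> lt (G · f) n.
Proof.
  intros hk hE; apply NNPP; intro hG; destruct bounded_search_exists as [b hb].
  (* [w · h · f] is nonzero iff [h] has a zero below [G · f]. *)
  assert (hw : exists w : M (ty1 ~> ty1 ~> N), forall h f, w · h · f = one ∸ (b · h · (G · f))) by lam.
  destruct hw as [w hw].
  assert (he : exists e : M ty2, forall h, e · h = k · (w · h)) by lam.
  destruct he as [e he]; apply (hE e); intro h; rewrite he; unfold is_kappa0 in hk; rewrite hk; split.
  - intros [f [_ hf]]; rewrite hw in hf.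
    assert (hz : b · h · (G · f) = zero) by (apply NNPP; intro; apply hf; now apply neg_eq_0).
    apply hb in hz as [i [_ hi]]; now exists i.
  (* Given a zero [n], unboundedness provides some [f] in Cantor space with [G · f] above [n]. *)
  - intros [n hn]; apply NNPP; intro hno; apply hG; exists (n ⊕ one); intros f hf.
    apply NNPP; intro hlt; apply hno; exists f; split; [exact hf|].
    rewrite hw; replace (b · h · (G · f)) with zero; [rewrite neg_0; apply one_neq_0|].
    symmetry; apply hb; exists n; split; [|exact hn].
    destruct (lt_total n (G · f)) as [|h']; [easy|]; destruct hlt; apply lt_succ.
    destruct h'; auto.
Qed.

(** Pairs [f, g] in Cantor space are coded by one point [h] of Cantor space; a choice [D] of a
    place where [f] and [g] differ whenever [Y f] and [Y g] do is bounded there. *)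
Lemma not_exists2_MUC (k : M ty3) : is_kappa0 k -> (forall E, ~ is_exists2 E) ->
  (forall c : M (ty2 ~> N ~> N), (forall Y, exists n, c · Y · n = zero) ->
     exists O : M ty3, forall Y, c · Y · (O · Y) = zero) ->
  holds M MUC.
Proof.
  intros hk hE hchoice; destruct unpair_exists as [l [r hlr]], bounded_search_exists as [b hb].
  (* Rows [zero] and [one] of [h] are the two coded points. Below, [d · h · n] vanishes iff they
     differ at [n], and [y · Y · h] iff [Y] agrees on them. *)
  assert (hp : exists p : M (N ~> ty1 ~> N ~> N), forall i h n, p · i · h · n = h · m_pair i n) by lam.
  destruct hp as [p hp].
  assert (hd : exists d : M (ty1 ~> N ~> N), forall h n,
    d · h · n = one ∸ (dist (p · zero · h · n) (p · one · h · n))) by lam.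
  destruct hd as [d hd].
  assert (hy : exists y : M (ty2 ~> ty1 ~> N), forall Y h,
    y · Y · h = dist (Y · (p · zero · h)) (Y · (p · one · h))) by lam.
  destruct hy as [y hy].
  assert (hz : exists z : M (ty2 ~> N ~> ty1 ~> N), forall Y n h,
    z · Y · n · h = (y · Y · h) ⊗ (b · (d · h) · n)) by lam.
  destruct hz as [z hz].
  (* [c · Y · n] vanishes iff no binary [h] makes [z · Y · n · h] nonzero, that is, iff points on
     which [Y] differs always differ below [n]. *)
  assert (hc : exists c : M (ty2 ~> N ~> N), forall Y n, c · Y · n = one ∸ (k · (z · Y · n))) by lam.
  destruct hc as [c hc].
  assert (hc0 : forall Y n, c · Y · n = zero <-> forall h, binary h -> z · Y · n · h = zero).
  { intros Y n; unfold is_kappa0 in hk; rewrite hc, neg_eq_0, hk; split.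
    - intros hno h hh; apply NNPP; intro; apply hno; now exists h.
    - intros hall [h [hh hne]]; auto. }
  destruct (hchoice c) as [O hO].
  { intro Y.
    assert (hx : exists x : M (ty1 ~> N ~> N), forall h n, x · h · n = (d · h · n) ⊗ (y · Y · h)) by lam.
    destruct hx as [x hx].
    destruct (choice_ty1 x) as [D hD].
    { intro h; destruct (classic (p · zero · h = p · one · h)) as [e|e].
      (* Equal rows have equal values under [Y], so any number will do. *)
      - exists zero; rewrite hx, hy, e; rewrite (proj2 (dist_eq_0 _ _)) by easy; ring.
      - apply NNPP; intro hno; apply e, ap_ext; intro n; apply NNPP; intro hn; apply hno.
        exists n; rewrite hx, hd; rewrite (proj2 (neg_eq_0 _)); [ring|].
        now rewrite dist_eq_0. }
    destruct (bounded_on_C D hk hE) as [n hn]; exists n; apply hc0; intros h hh.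
    rewrite hz; specialize (hD h); rewrite hx in hD; apply mul_eq_0 in hD as [e|e]; apply mul_eq_0.
    - right; apply hb; exists (D · h); split; [now apply hn | exact e].
    - now left. }
  apply (@holds_MUC O); intros Y f g hf hg hfg.
  (* Conversely, [f] and [g] are merged into one binary [h]: [f] on the codes with first component
     [zero], [g] on all others. *)
  assert (hh : exists h : M ty1, forall n, h · n =
    (one ∸ (l · n)) ⊗ (f · (r · n)) ⊕ (one ∸ (one ∸ (l · n))) ⊗ (g · (r · n))) by lam.
  destruct hh as [h hh].
  assert (h0 : p · zero · h = f).
  { apply ap_ext; intro n; rewrite hp, hh; destruct (hlr zero n) as [-> ->].
    rewrite neg_0, (proj2 (neg_eq_0 one)) by apply one_neq_0; ring. }
  assert (h1 : p · one · h = g).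
  { apply ap_ext; intro n; rewrite hp, hh; destruct (hlr one n) as [-> ->].
    rewrite (proj2 (neg_eq_0 one)) by apply one_neq_0; rewrite neg_0; ring. }
  assert (hbin : binary h).
  { intro n; rewrite hh; destruct (neg_bool (l · n)) as [-> | ->].
    - rewrite neg_0; replace (_ ⊕ _) with (g · (r · n)) by ring; apply hg.
    - rewrite (proj2 (neg_eq_0 one)) by apply one_neq_0.
      replace (_ ⊕ _) with (f · (r · n)) by ring; apply hf. }
  specialize (proj1 (hc0 Y (O · Y)) (hO Y) h hbin); rewrite hz, hy, h0, h1, mul_eq_0, dist_eq_0.
  intros [e|e]; [exact e|exfalso].
  apply hb in e as [i [hi e]]; rewrite hd, neg_eq_0, dist_eq_0, h0, h1 in e; auto.
Qed.

End Arithmetic.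

(** * The disjunction in models and its transfer to a derivation *)

Lemma kappa0_splits (M : model) :
  (forall A, theory_union WKL0w (QF_AC ty2 N) A -> holds M A) ->
  holds M (Imp kappa0 (Or MUC exists3)).
Proof.
  intros hM hk.
  assert (hR : forall A, RCA0w A -> holds M A) by (intros A hA; apply hM; left; now apply wkl_rca).
  apply (holds_kappa0 hR) in hk as [k hk].
  destruct (classic (exists E, is_exists2 M E)) as [[E hE]|hE].
  - right; exact (exists2_exists3 hR hk hE).
  - left; apply (not_exists2_MUC hR hk); [intros E h; apply hE; now exists E|].
    (* The instance of [QF-AC^{2,0}] has [c] as its parameter and the matrix [c · Y · n = 0]. *)
    exact (hM _ (or_intror (@qf_ac ty2 N [ty2 ~> N ~> N] (v2 @ v1 @ v0 [=] Zero) I))).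
Qed.

Theorem theorem3p5 (W : sentence)
  (hMUC : proves RCA0w (Imp MUC W))
  (hE3 : proves RCA0w (Imp exists3 W))
  (hk : proves RCA0w (Imp W kappa0)) :
  proves (theory_union WKL0w (QF_AC ty2 N)) (Iff W kappa0).
Proof.
  set (T := theory_union WKL0w (QF_AC ty2 N)).
  assert (hT : forall A, RCA0w A -> T A) by (intros A hA; left; now apply wkl_rca).
  assert (hT' : forall A, proves RCA0w A -> forall H, prv T (G := []) H A).
  { intros A hA H; eapply prv_weaken; [exact (prv_mono T hT hA) | intros B []]. }
  apply AndI; [apply hT', hk|].
  apply ImpI; eapply OrE.
  (* Completeness makes the disjunction derivable from [kappa0]; the two cases then use [hMUC] and
     [hE3]. *)
  - eapply ImpE; [|apply Hyp; now left].
    eapply prv_weaken; [exact (@completeness T hT _ kappa0_splits) | intros B []].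
  - eapply ImpE; [apply hT', hMUC | apply Hyp; now left].
  - eapply ImpE; [apply hT', hE3 | apply Hyp; now left].
Qed.
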